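(* Let $h=0$, $\rho>0$ and $\varepsilon\in(-\frac{J\rho}2,0]$. Define $\overline\mu=\frac{\sqrt{-2\varepsilon/J}}{\rho-(-2\varepsilon/J)}$ and $\eta=\frac1{2(\rho-(-2\varepsilon/J))}$. Let $I\subset\Lambda$ be an index set of fixed size, and let $f:\mathbb{R}^{|I|}\to\mathbb{R}$ be either a bounded $1$-Lipschitz function with respect to $\|\cdot\|_2$ or a finite product of coordinates of finite order. Then \[ \langle f\circ P_I\rangle_{\mathrm{MC}}^{\varepsilon,\rho;N}=\langle f\circ P_I\rangle_{\mathrm{AGC}}^{\overline\mu,\eta;N}+O(N^{-1/2}). \]
   Context: Mean-field spherical model with $h=0$: $\phi\in\mathbb{R}^N$ ($N=|\Lambda|$ sites), $J>0$, $H[\phi]=-\frac J{2N}(\sum_x\phi_x)^2$; $P_I$ restricts to sites in $I$. For $|m|<\sqrt\rho$, $\mu_{\mathrm{MC}}^{m,\rho;N}$ is the normalized uniform surface measure on $\{\sum\phi_x=mN,\ \sum\phi_x^2=\rho N\}$. For $\varepsilon\in(-\frac{\rho J}2,0)$, $\mu_{\mathrm{MC}}^{\varepsilon,\rho;N}=\frac12\mu_{\mathrm{MC}}^{\sqrt{-2\varepsilon/J},\rho;N}+\frac12\mu_{\mathrm{MC}}^{-\sqrt{-2\varepsilon/J},\rho;N}$, and $\mu_{\mathrm{MC}}^{0,\rho;N}$ is the $m=0$ ensemble. The alternate auxiliary grand canonical ensemble $\mu_{\mathrm{AGC}}^{\overline\mu,\eta;N}$ ($\overline\mu\ge0$, $\eta>0$)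 has density on $\mathbb{R}^N$ proportional to $e^{-\eta\sum_x\phi_x^2}\cosh(\overline\mu\sum_x\phi_x)$. *)

(* Defs.v *)
From HB Require Import structures.
From mathcomp Require Import all_boot all_order all_algebra.
From mathcomp Require Import all_classical all_reals all_analysis.
Set Implicit Arguments. Unset Strict Implicit. Unset Printing Implicit Defensive.
Import Order.TTheory GRing.Theory Num.Theory.
Local Open Scope ring_scope.

Section MeanFieldSpherical.
Variable R : realType.

Definition vcons (n : nat) (x : R) (v : 'I_n -> R) : 'I_n.+1 -> R :=
  fun i => match unlift ord0 i with Some j => v j | None => x end.

(** Lebesgue integral over R^n, defined as the iterated (n-fold) one-dimensional
    Lebesgue integral (equal to the integral against n-dimensional Lebesgue measure
    for integrable integrands, by Fubini). *)
Fixpoint intRn (n : nat) : (('I_n -> R) -> R) -> R :=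
  match n return (('I_n -> R) -> R) -> R with
  | 0 => fun g => g (fun _ => 0)
  | n'.+1 => fun g =>
      Rintegral (@lebesgue_measure R) setT (fun x => intRn (fun v => g (vcons x v)))
  end.

Definition sumx (n : nat) (phi : 'I_n -> R) : R := \sum_i phi i.
Definition sumsq (n : nat) (phi : 'I_n -> R) : R := \sum_i phi i ^+ 2.
Definition norm2 (n : nat) (phi : 'I_n -> R) : R := Num.sqrt (sumsq phi).

Definition coshR (x : R) : R := (expR x + expR (- x)) / 2.

Definition agc_weight (N : nat) (mub eta : R) (phi : 'I_N -> R) : R :=
  expR (- (eta * sumsq phi)) * coshR (mub * sumx phi).
Definition agc_expect (N : nat) (mub eta : R) (g : ('I_N -> R) -> R) : R :=
  @intRn N (fun phi => g phi * agc_weight mub eta phi) / @intRn N (agc_weight mub eta).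

(** Linear bijection from R^n onto the hyperplane {sum_x phi_x = 0} of R^(n+1):
    y |-> (y_1, ..., y_n, - sum y). *)
Definition hyp (n : nat) (y : 'I_n -> R) : 'I_n.+1 -> R :=
  fun i => match unlift ord_max i with Some j => y j | None => - sumx y end.

(** Microcanonical ensemble with magnetization m and energy constraint rho:
    expectation of g against the normalized uniform surface measure on the
    (N-2)-sphere {sum phi = m N, sum phi^2 = rho N} (N = n+1), which is the
    sphere of center m(1,...,1) and radius r = sqrt((rho - m^2) N) in the
    hyperplane {sum phi = m N}.  The normalized surface measure is given by the
    cone (polar-coordinate) definition: sigma(A) = Leb_H(cone of A)/Leb_H(ball),
    where Leb_H is Lebesgue measure on the hyperplane, computed in the linear
    coordinates [hyp] (which only change Leb_H by a constant factor). *)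
Definition mc_expect (N : nat) (m rho : R) : (('I_N -> R) -> R) -> R :=
  match N return (('I_N -> R) -> R) -> R with
  | 0 => fun _ => 0
  | n.+1 => fun g =>
      let r := Num.sqrt ((rho - m ^+ 2) * n.+1%:R) in
      let pt (y : 'I_n -> R) : 'I_n.+1 -> R :=
        fun i => m + r * (hyp y i / norm2 (hyp y)) in
      @intRn n (fun y => if norm2 (hyp y) <= 1 then g (pt y) else 0)
      / @intRn n (fun y => if norm2 (hyp y) <= 1 then 1 else 0)
  end.

Definition mc_eps_expect (N : nat) (J eps rho : R) (g : ('I_N -> R) -> R) : R :=
  if eps == 0 then mc_expect 0 rho g
  else (mc_expect (Num.sqrt (- (2 * eps) / J)) rho g
        + mc_expect (- Num.sqrt (- (2 * eps) / J)) rho g) / 2.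

(** P_I: restriction to the sites of I, where I is given by an injective
    enumeration iota : 'I_k -> 'I_N of its elements. *)
Definition projI (k N : nat) (iota : 'I_k -> 'I_N) (phi : 'I_N -> R) : 'I_k -> R :=
  fun j => phi (iota j).

Definition mubar (J eps rho : R) : R :=
  Num.sqrt (- (2 * eps) / J) / (rho - (- (2 * eps) / J)).
Definition eta_of (J eps rho : R) : R :=
  1 / (2 * (rho - (- (2 * eps) / J))).

Definition bounded_1lip (k : nat) (f : ('I_k -> R) -> R) : Prop :=
  (exists B : R, forall x, `|f x| <= B) /\
  (forall x y, `|f x - f y| <= norm2 (fun i => x i - y i)).
Definition coord_monomial (k : nat) (f : ('I_k -> R) -> R) : Prop :=
  exists a : 'I_k -> nat, f = (fun x => \prod_(i < k) x i ^+ a i).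

End MeanFieldSpherical.

(* Main.v *)
Require Import Defs.
From HB Require Import structures.
From mathcomp Require Import all_boot all_order all_algebra.
From mathcomp Require Import all_classical all_reals all_analysis.
From mathcomp Require Import measurable_realfun ring lra.
Import Order.TTheory GRing.Theory Num.Theory.
Import numFieldNormedType.Exports.
Local Open Scope classical_set_scope.
Local Open Scope ring_scope.
Set Implicit Arguments. Unset Strict Implicit. Unset Printing Implicit Defensive.

(** Let [s = rho - m^2], let [G] be a standard Gaussian vector of [R^N], and put
    [Y_i = G_i - (G_1 + ... + G_N) / N] and [u = Y / |Y|].  By rotation
    invariance in the hyperplane of zero sum, the microcanonical ensemble of
    magnetization [m] is the law of [m + sqrt (s N) u]: with the cone definition
    of the surface measure this only needs the layer-cake formula, Fubini and
    affine changes of variables.  Completing the square, the AGC ensemble is the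
    half-half mixture of the laws of [m + sqrt s G] and [- m + sqrt s G].  On this
    common probability space [sqrt N u_i - G_i = u_i (sqrt N - |Y|) - mean G] has
    second moment [O(1/N)]: [u] and [|Y|] decouple because functions of the
    direction are unaffected by rescaling the hyperplane, which turns the
    exponential moments of [|Y|^2 - N] into explicit powers.  Test
    functions of both kinds are Lipschitz up to a polynomial weight, so the
    Cauchy-Schwarz inequality gives the rate [N^(-1/2)]. *)

(** * One-dimensional integrals of Gaussian-dominated functions *)

Section LineIntegral.
Context {R : realType}.
Notation mu := (@lebesgue_measure R).
Implicit Types (f g : R -> R) (a b c C l x y : R).

(** [Rintegral] takes a default value when the integral diverges, so linearity, monotonicity and
    Fubini for the iterated [intRn] call for integrability at every level. This dictates two
    classes: [good] (Borel with a Gaussian bound) is stable under slicing, partial integration,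
    translation and scaling; [slow] (growth below every [exp (e |v|^2)]) is an algebra that lands in
    [good] once multiplied by a Gaussian.

    The delicate point of the coupling is the division by [|Y|]. No negative moment of [|Y|] is
    estimated: [u] is bounded, and the conjugate factor [sqrt N + |Y| >= sqrt N] trades
    [sqrt N - |Y|] for [N - |Y|^2]. The factor [u_i^2] has to stay inside the expectation, since its
    size [1 / N] supplies the rate; hence a variance bound for [|Y|^2] that carries an arbitrary
    nonnegative weight depending on the direction. Its tilts [t = +- 1 / (2 sqrt N)] live on the
    fluctuation scale of [|Y|^2], where [exp (- t N) (1 - 2 t)^(- n / 2)] stays bounded by [e]; a
    fixed tilt would cost a factor exponential in [N]. *)

Lemma lebesgue_measure_affine l b (A : set (measurableTypeR R)) :
  0 < l -> measurable A ->
  (l%:E * mu ((fun x => (l * x + b)%R) @^-1` A) = mu A)%E.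
Proof.
move=> l0 mA.
have mphi : measurable_fun [set: measurableTypeR R]
    (fun x : measurableTypeR R => l * x + b : measurableTypeR R).
  by apply: measurable_funD => //; exact: measurable_funM.
pose pm : {measure set (measurableTypeR R) -> \bar R} := pushforward mu
  (fun x : measurableTypeR R => l * x + b : measurableTypeR R).
have -> : (l%:E * mu ((fun x => (l * x + b)%R) @^-1` A) =
  mscale (NngNum (ltW l0)) (pm mphi) A)%E by [].
(* Both sides are measures in [A], so half-open intervals suffice; their preimages are again
   half-open intervals. *)
apply/esym/lebesgue_measure_unique => // _ [[u v]] _ <-.
transitivity (l%:E * mu `]((u - b) / l)%R, ((v - b) / l)%R]%classic)%E; last first.
  congr (_ * mu _)%E; apply/seteqP; split=> x /=;
  rewrite !in_itv/= ltr_pdivrMr// ler_pdivlMr// => /andP[h1 h2];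
  by apply/andP; split; lra.
rewrite !lebesgue_measure_itv/= !lte_fin ltr_pM2r ?invr_gt0// ltrD2r.
case: ifP => _; last by rewrite mule0.
by rewrite -!EFinD -EFinM; congr EFin; field; rewrite gt_eqF.
Qed.

Lemma ge0_integral_affine l b (f : R -> \bar R) : 0 < l ->
  measurable_fun setT f -> (forall x, 0 <= f x)%E ->
  (\int[mu]_x f x = l%:E * \int[mu]_x f (l * x + b)%R)%E.
Proof.
move=> l0 mf f0.
have mphi : measurable_fun [set: measurableTypeR R]
    (fun x : measurableTypeR R => l * x + b : measurableTypeR R).
  by apply: measurable_funD => //; exact: measurable_funM.
pose pm : {measure set (measurableTypeR R) -> \bar R} :=
  pushforward mu (fun x : measurableTypeR R => l * x + b : measurableTypeR R).
transitivity (\int[mscale (NngNum (ltW l0)) (pm mphi)]_x f x)%E.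
  apply: eq_measure_integral => A mA _; apply/esym.
  exact: lebesgue_measure_affine.
rewrite ge0_integral_mscale//=; congr (_ * _)%E.
by rewrite ge0_integral_pushforward//=; exact: lebesgue_measurableE.
Qed.

(** As [l > 0], finiteness of the scaled values forces [p] and [q] to be finite, so [fine] meets no
    infinity. *)
Lemma fineB_mull l (p q : \bar R) : 0 < l ->
  (l%:E * p)%E \is a fin_num -> (l%:E * q)%E \is a fin_num ->
  fine (l%:E * p - l%:E * q)%E = l * fine (p - q)%E.
Proof.
move=> l0; case: p => [p||]; case: q => [q||];
  by rewrite ?gt0_muley ?gt0_muleNy ?lte_fin//= => _ _; rewrite mulrBr.
Qed.

Lemma Rintegral_affine l b f : 0 < l -> mu.-integrable setT (EFin \o f) ->
  \int[mu]_x f x = l * \int[mu]_x f (l * x + b).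
Proof.
move=> l0 intf; have mf := measurable_int _ intf.
pose h x := (f (l * x + b))%:E.
have e1 : (\int[mu]_x (EFin \o f)^\+ x = l%:E * \int[mu]_x h^\+ x)%E.
  rewrite (ge0_integral_affine b l0)//; last exact: measurable_funepos.
  by congr (_ * _)%E; apply: eq_integral => x _; rewrite !(funeposE, funenegE).
have e2 : (\int[mu]_x (EFin \o f)^\- x = l%:E * \int[mu]_x h^\- x)%E.
  rewrite (ge0_integral_affine b l0)//; last exact: measurable_funeneg.
  by congr (_ * _)%E; apply: eq_integral => x _; rewrite !(funeposE, funenegE).
have f1 := integrable_pos_fin_num measurableT intf.
have f2 := integrable_neg_fin_num measurableT intf.
rewrite /Rintegral integralE -/h [in RHS]integralE; move: f1 f2; rewrite {}e1 {}e2.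
exact: fineB_mull.
Qed.

Lemma integrable_affine l b f : 0 < l -> mu.-integrable setT (EFin \o f) ->
  mu.-integrable setT (EFin \o (fun x => f (l * x + b))).
Proof.
move=> l0 /integrableP[mf intf].
have maff : measurable_fun [set: R] (fun x : R => l * x + b).
  by apply: measurable_funD => //; exact: measurable_funM.
apply/integrableP; split.
  by apply/measurable_EFinP; apply: measurableT_comp maff; exact/measurable_EFinP.
move: intf; rewrite (ge0_integral_affine b l0)//; last exact: measurableT_comp.
rewrite /= => intf; apply: contraTT intf; rewrite -!leNgt !leye_eq => /eqP ->.
by rewrite gt0_muley ?lte_fin.
Qed.

Lemma integrable_gaussian c : 0 < c ->
  mu.-integrable setT (EFin \o (fun x => expR (- (c * x ^+ 2)))).
Proof.
move=> c0; have := integrable_affine 0 (l:=Num.sqrt c) _ (@integrableT_gauss R).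
rewrite sqrtr_gt0 => /(_ c0).
by apply: eq_integrable => // x _ /=; rewrite /gauss_fun addr0 exprMn sqr_sqrtr// ltW.
Qed.

Lemma integrable_gaussianZ C c : 0 < c ->
  mu.-integrable setT (EFin \o (fun x => C * expR (- (c * x ^+ 2)))).
Proof.
move=> /integrable_gaussian /(integrableZl measurableT C).
by apply: eq_integrable => // x _ /=; rewrite EFinM.
Qed.

Lemma integrable_gauss_dom C c f : 0 < c -> measurable_fun setT f ->
  (forall x, `|f x| <= C * expR (- (c * x ^+ 2))) ->
  mu.-integrable setT (EFin \o f).
Proof.
move=> c0 mf fC.
apply: (le_integrable measurableT _ _ (integrableZl measurableT C (integrable_gaussian c0))).
  exact/measurable_EFinP.
by move=> x _ /=; rewrite lee_fin (le_trans (fC x)) ?ler_norm.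
Qed.

Definition gauss_mass c : R := \int[mu]_x expR (- (c * x ^+ 2)).

Lemma gauss_mass_gt0 c : 0 < c -> 0 < gauss_mass c.
Proof.
move=> c0; have sc0 : 0 < Num.sqrt c by rewrite sqrtr_gt0.
have := Rintegral_affine 0 sc0 (@integrableT_gauss R).
rewrite {1}/Rintegral integralT_gauss /= => e.
suff : 0 < Num.sqrt c * gauss_mass c by rewrite pmulr_rgt0.
suff -> : gauss_mass c = \int[mu]_x gauss_fun (Num.sqrt c * x + 0).
  by rewrite -e sqrtr_gt0 pi_gt0.
by apply: eq_Rintegral => x _; rewrite /gauss_fun addr0 exprMn sqr_sqrtr// ltW.
Qed.

Lemma norm_Rintegral_gauss_dom C c f : 0 < c -> measurable_fun setT f ->
  (forall x, `|f x| <= C * expR (- (c * x ^+ 2))) ->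
  `|\int[mu]_x f x| <= C * gauss_mass c.
Proof.
move=> c0 mf fC; have intf := integrable_gauss_dom c0 mf fC.
rewrite (le_trans (le_normr_Rintegral measurableT intf))// /gauss_mass.
rewrite -RintegralZl//; last exact: integrable_gaussian.
by apply: le_Rintegral => //; [exact: integrable_norm|exact: integrable_gaussianZ].
Qed.

(** The Gaussian bound makes every slice integrable, so the real iterated integrals agree with the
    extended ones, and its own double integral is finite, so Fubini applies. *)
Lemma Rintegral_swap C c (h : R -> R -> R) : 0 < c ->
  measurable_fun setT (fun z : R * R => h z.1 z.2) ->
  (forall x y, `|h x y| <= C * expR (- (c * x ^+ 2)) * expR (- (c * y ^+ 2))) ->
  \int[mu]_x \int[mu]_y h x y = \int[mu]_y \int[mu]_x h x y.
Proof.
move=> c0 mh hC.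
have i1 x : mu.-integrable setT (EFin \o h x).
  apply: (integrable_gauss_dom (C := C * expR (- (c * x ^+ 2))) c0 _ (hC x)).
  exact: (measurableT_comp mh (pair1_measurable x)).
have i2 y : mu.-integrable setT (EFin \o h^~ y).
  apply: (integrable_gauss_dom (C := C * expR (- (c * y ^+ 2))) c0); last first.
    by move=> x; rewrite mulrAC.
  exact: (measurableT_comp mh (pair2_measurable y)).
have e1 x : (\int[mu]_y (h x y)%:E)%E = (\int[mu]_y h x y)%:E.
  by rewrite /Rintegral fineK//; exact: integrable_fin_num (i1 x).
have e2 y : (\int[mu]_x (h x y)%:E)%E = (\int[mu]_x h x y)%:E.
  by rewrite /Rintegral fineK//; exact: integrable_fin_num (i2 y).
rewrite /Rintegral; congr fine.
under eq_integral do rewrite -/(Rintegral _ _ _) -e1.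
under [RHS]eq_integral do rewrite -/(Rintegral _ _ _) -e2.
apply: (@Fubini _ _ _ _ _ mu mu (fun z => (h z.1 z.2)%:E)).
apply/integrable12ltyP => /=; first exact/measurable_EFinP.
apply: (@le_lt_trans _ _ (\int[mu]_x (C * gauss_mass c * expR (- (c * x ^+ 2)))%:E)%E).
  apply: ge0_le_integral => //.
  - by move=> x _; exact: integral_ge0.
  - pose k (z : R * R) := `|(h z.1 z.2)%:E|%E.
    have mk : measurable_fun setT k.
      by apply: measurableT_comp => //; exact/measurable_EFinP.
    exact: (@measurable_fun_fubini_tonelli_F _ _ _ _ _ mu k mk (fun _ => abse_ge0 _)).
  - by apply/measurable_EFinP/measurable_funM => //; apply: measurableT_comp => //;
      apply: measurableT_comp => //; exact: measurable_funM.
  - move=> x _.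
    have ci := integrable_gaussianZ (C * expR (- (c * x ^+ 2))) c0.
    rewrite mulrAC -[leRHS]/((_ * (fine _))%:E) EFinM fineK; last first.
      by apply: (integrable_fin_num measurableT); exact: integrable_gaussian.
    rewrite -integralZl//; last exact: integrable_gaussian.
    apply: ge0_le_integral => //.
    + by case/integrableP: (integrable_abse (i1 x)).
    + by case/integrableP: ci.
    + by move=> y _; rewrite /= lee_fin.
by apply: integrable_lty => //; exact: integrable_gaussianZ.
Qed.

End LineIntegral.

(** * Iterated integrals *)

Section SpaceIntegral.
Context {R : realType}.
Notation mu := (@lebesgue_measure R).

Lemma vcons0 n (x : R) (v : 'I_n -> R) : vcons x v ord0 = x.
Proof. by rewrite /vcons unlift_none. Qed.

Lemma vcons_lift n (x : R) (v : 'I_n -> R) j : vcons x v (lift ord0 j) = v j.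
Proof. by rewrite /vcons liftK. Qed.

Lemma vcons_eta n (w : 'I_n.+1 -> R) :
  vcons (w ord0) (fun j => w (lift ord0 j)) = w.
Proof.
by apply/funext => i; case: (unliftP ord0 i) => [j|] ->; rewrite ?vcons0 ?vcons_lift.
Qed.

Lemma vcons_tail n (x : R) (v : 'I_n -> R) : (fun j => vcons x v (lift ord0 j)) = v.
Proof. by apply/funext => j; rewrite vcons_lift. Qed.

Lemma sumsq_vcons n (x : R) (v : 'I_n -> R) : sumsq (vcons x v) = x ^+ 2 + sumsq v.
Proof.
rewrite /sumsq big_ord_recl vcons0; congr (_ + _).
by apply: eq_bigr => i _; rewrite vcons_lift.
Qed.

Lemma sumsq_ge0 n (v : 'I_n -> R) : 0 <= sumsq v.
Proof. by apply: sumr_ge0 => i _; exact: sqr_ge0. Qed.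

Lemma sumsq0 (v : 'I_0 -> R) : sumsq v = 0.
Proof. by rewrite /sumsq big_ord0. Qed.

(* Stability under composition with measurable coordinates, rather than
   measurability for a sigma-algebra on ['I_n -> R]. *)
Definition borel_fun n (g : ('I_n -> R) -> R) : Prop :=
  forall d (T : measurableType d) (c : 'I_n -> T -> R),
    (forall i, measurable_fun [set: T] (c i)) ->
    measurable_fun [set: T] (fun t => g (fun i => c i t)).

Definition gauss_dom n (C c : R) (g : ('I_n -> R) -> R) : Prop :=
  forall v, `|g v| <= C * expR (- (c * sumsq v)).

(** Integrability of the whole function would not control each slice and each partial integral; a
    pointwise Gaussian bound does. *)
Definition good n (g : ('I_n -> R) -> R) : Prop :=
  borel_fun g /\ exists C c, 0 < c /\ gauss_dom C c g.

(** Decay is demanded in the parameters [p] as well, so that integrating out [v] leaves a [good]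
    function of [p]. *)
Definition good2 m n (G : ('I_m -> R) -> ('I_n -> R) -> R) : Prop :=
  (forall d (T : measurableType d) (a : 'I_m -> T -> R) (b : 'I_n -> T -> R),
    (forall i, measurable_fun [set: T] (a i)) ->
    (forall i, measurable_fun [set: T] (b i)) ->
    measurable_fun [set: T] (fun t => G (fun i => a i t) (fun i => b i t))) /\
  exists C c, 0 < c /\
    forall p v, `|G p v| <= C * expR (- (c * sumsq p)) * expR (- (c * sumsq v)).

Lemma measurable_vcons d (T : measurableType d) n (x : T -> R) (c : 'I_n -> T -> R) :
  measurable_fun [set: T] x -> (forall i, measurable_fun [set: T] (c i)) ->
  forall i, measurable_fun [set: T] (fun t => vcons (x t) (fun j => c j t) i).
Proof.
move=> mx mc i; case: (unliftP ord0 i) => [j|] ->.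
  under eq_fun do rewrite vcons_lift.
  exact: mc.
under eq_fun do rewrite vcons0.
exact: mx.
Qed.

Lemma gauss_dom_coeff_ge0 n C c (f : ('I_n -> R) -> R) : gauss_dom C c f -> 0 <= C.
Proof.
move=> /(_ (fun=> 0)) /(le_trans (normr_ge0 _)).
by rewrite pmulr_lge0 ?expR_gt0.
Qed.

Lemma gauss_dom_vcons n C c (g : ('I_n.+1 -> R) -> R) x : gauss_dom C c g ->
  gauss_dom (C * expR (- (c * x ^+ 2))) c (fun v => g (vcons x v)).
Proof.
by move=> gC v; rewrite (le_trans (gC _))// sumsq_vcons mulrDr opprD expRD mulrA.
Qed.

Lemma borel_vcons n (g : ('I_n.+1 -> R) -> R) x : borel_fun g ->
  borel_fun (fun v => g (vcons x v)).
Proof. by move=> mg d T c mc; apply/mg/measurable_vcons. Qed.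

Lemma good_vcons n (g : ('I_n.+1 -> R) -> R) x : good g ->
  good (fun v => g (vcons x v)).
Proof.
move=> [mg [C [c [c0 gC]]]]; split; first exact: borel_vcons.
by exists (C * expR (- (c * x ^+ 2))), c; split=> //; exact: gauss_dom_vcons.
Qed.

Lemma borel_line n (g : ('I_n.+1 -> R) -> R) v : borel_fun g ->
  measurable_fun [set: R] (fun x => g (vcons x v)).
Proof.
move=> mg; apply: (mg _ _ (fun i x => vcons x v i)).
by apply: (@measurable_vcons _ R n id (fun i _ => v i)).
Qed.

Lemma gauss_dom_line n C c (g : ('I_n.+1 -> R) -> R) v : gauss_dom C c g ->
  forall x, `|g (vcons x v)| <= C * expR (- (c * sumsq v)) * expR (- (c * x ^+ 2)).
Proof. by move=> gC x; rewrite mulrAC; exact: gauss_dom_vcons. Qed.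

Lemma good_line n (g : ('I_n.+1 -> R) -> R) v : good g ->
  mu.-integrable setT (EFin \o (fun x => g (vcons x v))).
Proof.
move=> [mg [C [c [c0 gC]]]].
exact: integrable_gauss_dom c0 (borel_line v mg) (gauss_dom_line v gC).
Qed.

(** Tonelli is applied to the positive and negative parts separately, since only measurability is
    assumed. *)
Lemma borel_Rintegral n (g : ('I_n.+1 -> R) -> R) : borel_fun g ->
  borel_fun (fun v => \int[mu]_x g (vcons x v)).
Proof.
move=> mg d T c mc.
pose f (z : T * R) := (g (vcons z.2 (fun i => c i z.1)))%:E.
have mf : measurable_fun setT f.
  apply/measurable_EFinP; apply: mg; apply: measurable_vcons => // i.
  exact: measurableT_comp (mc i) measurable_fst.
rewrite /Rintegral; apply: measurableT_comp => //.
under eq_fun do rewrite integralE.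
apply: emeasurable_funB.
- rewrite [X in measurable_fun _ X](_ : _ = fubini_F mu f^\+%E); last first.
    by apply/funext => t; apply: eq_integral => x _; rewrite !funeposE.
  apply: measurable_fun_fubini_tonelli_F; first exact: measurable_funepos.
  exact: funepos_ge0.
- rewrite [X in measurable_fun _ X](_ : _ = fubini_F mu f^\-%E); last first.
    by apply/funext => t; apply: eq_integral => x _; rewrite !funenegE.
  apply: measurable_fun_fubini_tonelli_F; first exact: measurable_funeneg.
  exact: funeneg_ge0.
Qed.

Lemma good_Rintegral n (g : ('I_n.+1 -> R) -> R) : good g ->
  good (fun v => \int[mu]_x g (vcons x v)).
Proof.
move=> [mg [C [c [c0 gC]]]]; split; first exact: borel_Rintegral.
exists (C * gauss_mass c), c; split=> // v.
rewrite mulrAC.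
exact: norm_Rintegral_gauss_dom c0 (borel_line v mg) (gauss_dom_line v gC).
Qed.

(** The induction moves the first integration variable among the parameters, which is why [m]
    varies: the inner integral is good in [m.+1] variables, and [good_Rintegral] removes the extra
    one. *)
Lemma good_intRn m n (G : ('I_m -> R) -> ('I_n -> R) -> R) : good2 G ->
  good (fun p => intRn (G p)).
Proof.
elim: n m G => [|n IH] m G [mG [C [c [c0 GC]]]] /=.
  split.
    by move=> d T a ma; apply: (mG _ _ a (fun _ _ => 0)).
  exists C, c; split => // p; rewrite (le_trans (GC _ _))//.
  by rewrite sumsq0 mulr0 oppr0 expR0 mulr1.
pose H (w : 'I_m.+1 -> R) :=
  intRn (fun v => G (fun j => w (lift ord0 j)) (vcons (w ord0) v)).
have -> : (fun p => \int[mu]_x intRn (fun v => G p (vcons x v))) =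
    (fun p => \int[mu]_x H (vcons x p)).
  by apply/funext => p; apply: eq_Rintegral => x _; rewrite /H vcons_tail vcons0.
apply/good_Rintegral/IH; split.
  by move=> d T a b ma mb; apply: mG => //; apply: measurable_vcons.
exists C, c; split => // p v; rewrite (le_trans (GC _ _))//.
rewrite -[in leRHS](vcons_eta p) !sumsq_vcons !mulrDr !opprD !expRD.
by rewrite le_eqVlt; apply/orP; left; apply/eqP; ring.
Qed.

Lemma good_good2 n (g : ('I_n.+1 -> R) -> R) : good g ->
  good2 (fun (p : 'I_1 -> R) v => g (vcons (p ord0) v)).
Proof.
move=> [mg [C [c [c0 gC]]]]; split.
  by move=> d T a b ma mb; apply: mg; exact: measurable_vcons.
exists C, c; split => // p v; rewrite (le_trans (gauss_dom_vcons _ gC _))//.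
by rewrite /sumsq big_ord1.
Qed.

Lemma good1_line (g : R -> R) : good (fun p : 'I_1 -> R => g (p ord0)) ->
  measurable_fun setT g /\ mu.-integrable setT (EFin \o g).
Proof.
move=> gg; have [mg _] := gg; have ig := good_line (fun=> 0) gg; split.
  by have := borel_line (fun _ => 0) mg; under eq_fun do rewrite vcons0.
by move: ig; apply: eq_integrable => // x _ /=; rewrite vcons0.
Qed.

Lemma integrable_intRn n (g : ('I_n.+1 -> R) -> R) : good g ->
  mu.-integrable setT (EFin \o (fun x => intRn (fun v => g (vcons x v)))).
Proof.
move=> /good_good2 /good_intRn gg.
by have [] := @good1_line (fun x => intRn (fun v => g (vcons x v))) gg.
Qed.

Lemma eq_intRn n (f g : ('I_n -> R) -> R) : f =1 g -> intRn f = intRn g.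
Proof. by move=> /funext ->. Qed.

Lemma goodD n (f g : ('I_n -> R) -> R) : good f -> good g -> good (fun v => f v + g v).
Proof.
move=> [mf [C [c [c0 fC]]]] [mg [D [d [d0 gD]]]]; split.
  by move=> ? T a ma; apply: measurable_funD; [exact: mf|exact: mg].
have C0 := gauss_dom_coeff_ge0 fC.
have D0 := gauss_dom_coeff_ge0 gD.
exists (C + D), (Num.min c d); split; first by rewrite lt_min c0.
move=> v; rewrite (le_trans (ler_normD _ _))// mulrDl lerD//.
- rewrite (le_trans (fC v))// ler_wpM2l// ler_expR lerN2 ler_wpM2r ?sumsq_ge0//.
  by rewrite ge_min lexx.
- rewrite (le_trans (gD v))// ler_wpM2l// ler_expR lerN2 ler_wpM2r ?sumsq_ge0//.
  by rewrite ge_min lexx orbT.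
Qed.

Lemma goodZ n a (f : ('I_n -> R) -> R) : good f -> good (fun v => a * f v).
Proof.
move=> [mf [C [c [c0 fC]]]]; split.
  by move=> ? T b mb; apply: measurable_funM => //; exact: mf.
exists (`|a| * C), c; split=> // v.
by rewrite normrM -mulrA ler_wpM2l.
Qed.

Lemma intRnD n (f g : ('I_n -> R) -> R) : good f -> good g ->
  intRn (fun v => f v + g v) = intRn f + intRn g.
Proof.
elim: n f g => [//|n IH] f g gf gg /=.
rewrite -RintegralD//; [|exact: integrable_intRn..].
by apply: eq_Rintegral => x _; rewrite IH//; exact: good_vcons.
Qed.

Lemma intRnZ n a (f : ('I_n -> R) -> R) : good f ->
  intRn (fun v => a * f v) = a * intRn f.
Proof.
elim: n f => [//|n IH] f gf /=.
rewrite -RintegralZl//; last exact: integrable_intRn.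
by apply: eq_Rintegral => x _; rewrite IH//; exact: good_vcons.
Qed.

Lemma le_intRn n (f g : ('I_n -> R) -> R) : good f -> good g ->
  (forall v, f v <= g v) -> intRn f <= intRn g.
Proof.
elim: n f g => [|n IH] f g gf gg fg; first exact: fg.
apply: le_Rintegral => //; [exact: integrable_intRn..|].
by move=> x _; apply: IH => //; exact: good_vcons.
Qed.

Lemma intRn_ge0 n (f : ('I_n -> R) -> R) : (forall v, 0 <= f v) -> 0 <= intRn f.
Proof.
elim: n f => [|n IH] f f0; first exact: f0.
by apply: Rintegral_ge0 => x _; exact: IH.
Qed.

(** Lets a Gaussian bound survive a translation at the cost of half its rate. *)
Lemma sumsqD_ge n (u v : 'I_n -> R) :
  sumsq u / 2 - sumsq v <= sumsq (fun i => u i + v i).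
Proof.
rewrite /sumsq mulr_suml -sumrB; apply: ler_sum => i _.
rewrite -subr_ge0 (_ : _ - _ = (u i + 2 * v i) ^+ 2 / 2); last by field.
by rewrite divr_ge0 ?sqr_ge0.
Qed.

Lemma good_translate n (c : 'I_n -> R) (f : ('I_n -> R) -> R) : good f ->
  good (fun v => f (fun i => v i + c i)).
Proof.
move=> [mf [C [k [k0 fC]]]]; split.
  by move=> d T a ma; apply: mf => i; exact: measurable_funD.
exists (C * expR (k * sumsq c)), (k / 2); split; first by rewrite divr_gt0.
move=> v; rewrite (le_trans (fC _))// -mulrA ler_wpM2l ?(gauss_dom_coeff_ge0 fC)//.
rewrite -expRD ler_expR; have := ler_wpM2l (ltW k0) (sumsqD_ge v c); lra.
Qed.

Lemma intRn_translate n (c : 'I_n -> R) (f : ('I_n -> R) -> R) : good f ->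
  intRn (fun v => f (fun i => v i + c i)) = intRn f.
Proof.
elim: n c f => [|n IH] c f gf /=; first by congr f; apply/funext; case.
rewrite [RHS](Rintegral_affine (c ord0) ltr01 (integrable_intRn gf)) mul1r.
apply: eq_Rintegral => x _; rewrite mul1r.
rewrite -[RHS](IH (fun j => c (lift ord0 j)))//; last exact: good_vcons.
apply: eq_intRn => v; congr f; apply/funext => i.
by case: (unliftP ord0 i) => [j|] ->; rewrite ?vcons0 ?vcons_lift.
Qed.

Lemma sumsqZ n l (v : 'I_n -> R) : sumsq (fun i => l * v i) = l ^+ 2 * sumsq v.
Proof. by rewrite /sumsq mulr_sumr; apply: eq_bigr => i _; rewrite exprMn. Qed.

Lemma good_scale n l (f : ('I_n -> R) -> R) : 0 < l -> good f ->
  good (fun v => f (fun i => l * v i)).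
Proof.
move=> l0 [mf [C [k [k0 fC]]]]; split.
  by move=> d T a ma; apply: mf => i; exact: measurable_funM.
exists C, (k * l ^+ 2); split; first by rewrite mulr_gt0 ?exprn_gt0.
by move=> v; rewrite -mulrA -sumsqZ.
Qed.

Lemma intRn_scale n l (f : ('I_n -> R) -> R) : 0 < l -> good f ->
  intRn f = l ^+ n * intRn (fun v => f (fun i => l * v i)).
Proof.
move=> l0; elim: n f => [|n IH] f gf /=.
  by rewrite mul1r; congr f; apply/funext; case.
rewrite [LHS](Rintegral_affine 0 l0 (integrable_intRn gf)) exprS -mulrA; congr (_ * _).
rewrite -RintegralZl//; last exact: (integrable_intRn (good_scale l0 gf)).
apply: eq_Rintegral => x _; rewrite addr0 IH; last exact: good_vcons.
congr (_ * _); apply: eq_intRn => v; congr f; apply/funext => i.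
by case: (unliftP ord0 i) => [j|] ->; rewrite ?vcons0 ?vcons_lift.
Qed.

(** Adjacent transpositions: planar Fubini exchanges the first two variables, the others being
    already integrated out; the induction hypothesis then acts with the second one frozen. *)
Lemma intRn_swap n (f : ('I_n.+1 -> R) -> R) : good f ->
  intRn f = intRn (fun v => \int[mu]_x f (vcons x v)).
Proof.
elim: n f => [|n IH] f gf; first by [].
transitivity (\int[mu]_y \int[mu]_x intRn (fun v => f (vcons x (vcons y v)))).
  have [mf [C [c [c0 fC]]]] := gf.
  have g2 : good (fun p : 'I_2 -> R =>
      intRn (fun v => f (vcons (p ord0) (vcons (p (lift ord0 ord0)) v)))).
    apply: good_intRn; split.
      by move=> d T a b ma mb; apply: mf; do 2 apply: measurable_vcons => //.
    exists C, c; split => // p v; rewrite (le_trans (fC _))//.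
    rewrite !sumsq_vcons /sumsq big_ord_recl big_ord1 -!mulrA !mulrDr !opprD !expRD.
    by rewrite !mulrA.
  have [m2 [D [k [k0 gD]]]] := g2.
  apply: (@Rintegral_swap _ D k _ k0).
    pose cc (i : 'I_2) (z : R * R) := vcons z.1 (fun _ : 'I_1 => z.2) i.
    have mcc i : measurable_fun setT (cc i).
      exact: (@measurable_vcons _ (R * R)%type 1 fst (fun _ z => z.2)
        measurable_fst (fun _ => measurable_snd)).
    have := m2 _ _ cc mcc; rewrite /cc.
    by under eq_fun do rewrite vcons0 vcons_lift.
  move=> x y; have := gD (vcons x (fun _ : 'I_1 => y)).
  by rewrite vcons0 vcons_lift sumsq_vcons /sumsq big_ord1 mulrDr opprD expRD mulrA.
rewrite /=; apply: eq_Rintegral => y _.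
have gy : good (fun w : 'I_n.+1 -> R => f (vcons (w ord0) (vcons y (fun j => w (lift ord0 j))))).
  have [mf [C [c [c0 fC]]]] := gf; split.
    by move=> d T a ma; apply: mf; do 2 apply: measurable_vcons => //.
  exists C, c; split=> // w; rewrite (le_trans (fC _))// ler_wpM2l ?(gauss_dom_coeff_ge0 fC)//.
  rewrite ler_expR lerN2; apply: ler_wpM2l; first exact: ltW.
  rewrite -[leLHS](congr1 (@sumsq R _) (vcons_eta w)) !sumsq_vcons.
  by rewrite lerD2l lerDr sqr_ge0.
have := IH _ gy; rewrite /=.
under eq_Rintegral do under eq_intRn do rewrite vcons0 vcons_tail.
by under [in RHS]eq_intRn do under eq_Rintegral do rewrite vcons0 vcons_tail.
Qed.

(** Matches [hyp], whose dependent coordinate is the last: [hyp y] is [vsnoc y (- sumx y)]. *)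
Definition vsnoc n (v : 'I_n -> R) (x : R) : 'I_n.+1 -> R :=
  fun i => match unlift ord_max i with Some j => v j | None => x end.

Lemma vsnoc_max n (v : 'I_n -> R) x : vsnoc v x ord_max = x.
Proof. by rewrite /vsnoc unlift_none. Qed.

Lemma vsnoc_lift n (v : 'I_n -> R) x j : vsnoc v x (lift ord_max j) = v j.
Proof. by rewrite /vsnoc liftK. Qed.

Lemma vsnoc_vcons n x (v : 'I_n -> R) y : vsnoc (vcons x v) y = vcons x (vsnoc v y).
Proof.
apply/funext => i; case: (unliftP ord0 i) => [j|] ->.
  rewrite vcons_lift; case: (unliftP ord_max j) => [k|] ->.
    have -> : lift ord0 (lift ord_max k) = lift ord_max (lift ord0 k) :> 'I_n.+2.
      by apply: val_inj; rewrite /= /bump !leq0n !add1n ltnS addnS.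
    by rewrite !vsnoc_lift vcons_lift.
  have -> : lift ord0 ord_max = ord_max :> 'I_n.+2 by exact: val_inj.
  by rewrite !vsnoc_max.
have -> : ord0 = lift ord_max ord0 :> 'I_n.+2 by exact: val_inj.
rewrite vsnoc_lift vcons0.
have -> : lift ord_max ord0 = ord0 :> 'I_n.+2 by exact: val_inj.
by rewrite vcons0.
Qed.

(** Pure reindexing: the last coordinate is already the innermost one. *)
Lemma intRn_snoc n (f : ('I_n.+1 -> R) -> R) :
  intRn f = intRn (fun v => \int[mu]_x f (vsnoc v x)).
Proof.
elim: n f => [|n IH] f /=.
  apply: eq_Rintegral => x _; congr f; apply/funext => i.
  have -> : i = ord0 by apply: val_inj; case: i => -[].
  have e : ord0 = ord_max :> 'I_1 by exact: val_inj.
  by rewrite vcons0 e vsnoc_max.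
apply: eq_Rintegral => y _.
rewrite -[LHS]/(intRn (fun v : 'I_n.+1 -> R => f (vcons y v))) IH.
apply: eq_intRn => v; apply: eq_Rintegral => x _.
by rewrite vsnoc_vcons.
Qed.

End SpaceIntegral.

(** * Gaussian expectations *)

Section GaussianExpectation.
Context {R : realType}.
Notation mu := (@lebesgue_measure R).

(** * Closure properties of Borel functions *)

Section Borel.
Variable n : nat.
Implicit Types f g : ('I_n -> R) -> R.

Lemma borel_cst a : borel_fun (fun _ : 'I_n -> R => a).
Proof. by []. Qed.

Lemma borel_coord i : borel_fun (fun v : 'I_n -> R => v i).
Proof. by move=> d T c; exact. Qed.

Lemma borel_comp k (g : ('I_k -> R) -> R) (c : 'I_k -> ('I_n -> R) -> R) :
  borel_fun g -> (forall j, borel_fun (c j)) -> borel_fun (fun v => g (fun j => c j v)).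
Proof. by move=> mg mc d T a ma; apply: mg => j; exact: mc. Qed.

Lemma borel_comp1 (phi : R -> R) g : measurable_fun setT phi -> borel_fun g ->
  borel_fun (fun v => phi (g v)).
Proof. by move=> mphi mg d T c mc; exact: measurableT_comp mphi (mg _ _ _ mc). Qed.

Lemma borelD f g : borel_fun f -> borel_fun g -> borel_fun (fun v => f v + g v).
Proof. by move=> mf mg d T c mc; apply: measurable_funD; [exact: mf|exact: mg]. Qed.

Lemma borelN f : borel_fun f -> borel_fun (fun v => - f v).
Proof. by move=> mf d T c mc; apply: measurable_funN; exact: mf. Qed.

Lemma borelM f g : borel_fun f -> borel_fun g -> borel_fun (fun v => f v * g v).
Proof. by move=> mf mg d T c mc; apply: measurable_funM; [exact: mf|exact: mg]. Qed.

Lemma borelX f p : borel_fun f -> borel_fun (fun v => f v ^+ p).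
Proof. by move=> mf d T c mc; apply: measurable_funX; exact: mf. Qed.

Lemma borel_expR f : borel_fun f -> borel_fun (fun v => expR (f v)).
Proof. exact: borel_comp1. Qed.

Lemma borel_norm f : borel_fun f -> borel_fun (fun v => `|f v|).
Proof. exact: borel_comp1. Qed.

Lemma borel_sqrt f : borel_fun f -> borel_fun (fun v => Num.sqrt (f v)).
Proof.
by apply: borel_comp1; apply: continuous_measurable_fun; exact: sqrt_continuous.
Qed.

Lemma borelV f : (forall v, 0 <= f v) -> borel_fun f -> borel_fun (fun v => (f v)^-1).
Proof.
move=> f0 mf; rewrite (_ : (fun v => (f v)^-1) = (fun v => powR (f v) (-1))).
  by apply: (borel_comp1 (phi := fun x => powR x (-1)) _ mf); exact: measurable_powR.
by apply/funext => v; rewrite powR_inv1.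
Qed.

Lemma borel_sum (I : Type) (s : seq I) (h : I -> ('I_n -> R) -> R) :
  (forall i, borel_fun (h i)) -> borel_fun (fun v => \sum_(i <- s) h i v).
Proof. by move=> mh d T c mc; apply: measurable_sum => i; exact: mh. Qed.

Lemma borel_if_le f g (h1 h2 : ('I_n -> R) -> R) :
  borel_fun f -> borel_fun g -> borel_fun h1 -> borel_fun h2 ->
  borel_fun (fun v => if f v <= g v then h1 v else h2 v).
Proof.
move=> mf mg m1 m2 d T c mc; apply: measurable_fun_ifT; [|exact: m1|exact: m2].
by apply: measurable_fun_ler; [exact: mf|exact: mg].
Qed.

Lemma borel_sumx : borel_fun (@sumx R n).
Proof. by apply: borel_sum => i; exact: borel_coord. Qed.

Lemma borel_sumsq : borel_fun (@sumsq R n).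
Proof. by apply: borel_sum => i; apply: borelX; exact: borel_coord. Qed.

Lemma borel_norm2 : borel_fun (@norm2 R n).
Proof. exact: borel_sqrt borel_sumsq. Qed.

End Borel.

Lemma norm2_ge0 n (v : 'I_n -> R) : 0 <= norm2 v.
Proof. exact: sqrtr_ge0. Qed.

Lemma norm2_sq n (v : 'I_n -> R) : norm2 v ^+ 2 = sumsq v.
Proof. by rewrite sqr_sqrtr// sumsq_ge0. Qed.

Lemma sqr_coord_le n (v : 'I_n -> R) i : v i ^+ 2 <= sumsq v.
Proof.
by rewrite /sumsq (bigD1 i)//= lerDl; apply: sumr_ge0 => j _; exact: sqr_ge0.
Qed.

Lemma ge_norm2_coord n (v : 'I_n -> R) i : `|v i| <= norm2 v.
Proof.
by rewrite -sqrtr_sqr ler_wsqrtr// sqr_coord_le.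
Qed.

Lemma norm2Z n l (v : 'I_n -> R) : 0 <= l -> norm2 (fun i => l * v i) = l * norm2 v.
Proof. by move=> l0; rewrite /norm2 sumsqZ sqrtrM ?sqr_ge0// sqrtr_sqr ger0_norm. Qed.

Lemma norm2_le_sum n (v : 'I_n -> R) : norm2 v <= \sum_i `|v i|.
Proof.
have S0 : 0 <= \sum_i `|v i| by apply: sumr_ge0.
rewrite -[leRHS]ger0_norm// -sqrtr_sqr ler_wsqrtr// /sumsq expr2 mulr_suml.
apply: ler_sum => i _; rewrite -real_normK ?num_real// expr2 ler_wpM2l//.
by rewrite (bigD1 i)//= lerDl sumr_ge0.
Qed.

(** Unlike [good], this class contains polynomials and exponentials of linear forms and is closed
    under products. *)
Definition slow n (X : ('I_n -> R) -> R) : Prop :=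
  borel_fun X /\ forall e, 0 < e -> exists C, gauss_dom C (- e) X.

Section Slow.
Variable n : nat.
Implicit Types X Y : ('I_n -> R) -> R.

Lemma slow_bounded X B : borel_fun X -> (forall v, `|X v| <= B) -> slow X.
Proof.
move=> mX XB; split=> // e e0; exists B => v; rewrite (le_trans (XB v))//.
have B0 : 0 <= B by exact: le_trans (XB v).
by rewrite ler_peMr// mulNr opprK -expR0 ler_expR mulr_ge0 ?sumsq_ge0// ltW.
Qed.

Lemma slow_cst a : slow (fun _ : 'I_n -> R => a).
Proof. by apply: (@slow_bounded _ `|a|). Qed.

Lemma slowM X Y : slow X -> slow Y -> slow (fun v => X v * Y v).
Proof.
move=> [mX sX] [mY sY]; split; first exact: borelM.
move=> e e0; have e20 : 0 < e / 2 by rewrite divr_gt0.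
have [C XC] := sX _ e20; have [D YD] := sY _ e20; exists (C * D) => v.
rewrite normrM (le_trans (ler_pM _ _ (XC v) (YD v)))// mulrACA -expRD.
by rewrite ler_wpM2l ?mulr_ge0 ?(gauss_dom_coeff_ge0 XC) ?(gauss_dom_coeff_ge0 YD)// ler_expR; lra.
Qed.

Lemma slowD X Y : slow X -> slow Y -> slow (fun v => X v + Y v).
Proof.
move=> [mX sX] [mY sY]; split; first exact: borelD.
move=> e e0; have [C XC] := sX _ e0; have [D YD] := sY _ e0; exists (C + D) => v.
by rewrite (le_trans (ler_normD _ _))// mulrDl lerD.
Qed.

Lemma slowN X : slow X -> slow (fun v => - X v).
Proof.
move=> [mX sX]; split; first exact: borelN.
by move=> e /sX[C XC]; exists C => v; rewrite normrN.
Qed.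

Lemma slow_norm X : slow X -> slow (fun v => `|X v|).
Proof.
move=> [mX sX]; split; first exact: borel_norm.
by move=> e /sX[C XC]; exists C => v; rewrite normr_id.
Qed.

Lemma slowX X p : slow X -> slow (fun v => X v ^+ p).
Proof.
move=> sX; elim: p => [|p IH]; first exact: slow_cst.
rewrite (_ : (fun v => X v ^+ p.+1) = (fun v => X v * X v ^+ p)); first exact: slowM.
by apply/funext => v; rewrite exprS.
Qed.

Lemma slow_sum (I : Type) (s : seq I) (h : I -> ('I_n -> R) -> R) :
  (forall i, slow (h i)) -> slow (fun v => \sum_(i <- s) h i v).
Proof.
move=> sh; elim: s => [|i s IH].
  by under [X in slow X]funext do rewrite big_nil; exact: slow_cst.
by under [X in slow X]funext do rewrite big_cons; exact: slowD.
Qed.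

Lemma slow_expR_linear (c : 'I_n -> R) :
  slow (fun v => expR (\sum_i c i * v i)).
Proof.
split.
  by apply: borel_expR; apply: borel_sum => i; apply: borelM => //; exact: borel_coord.
(* [c i ^ 2 / (4 * e)] is the maximum of [c i * x - e * x ^ 2] over [x]. *)
move=> e e0; exists (expR (sumsq c / (4 * e))) => v.
rewrite ger0_norm ?expR_ge0// -expRD ler_expR mulNr opprK.
rewrite /sumsq mulr_suml mulr_sumr -big_split/=; apply: ler_sum => i _.
rewrite -subr_ge0 (_ : _ - _ = (c i - 2 * e * v i) ^+ 2 / (4 * e)); last first.
  by field; rewrite gt_eqF.
by rewrite divr_ge0 ?sqr_ge0// mulr_ge0// ltW.
Qed.

Lemma slow_coord i : slow (fun v : 'I_n -> R => v i).
Proof.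
split; first exact: borel_coord.
(* AM-GM gives [|x| <= 1 / (4 e) + e x^2], and [1 / (4 e) + t <= (1 + 1 / (4 e)) exp t] for
   [t >= 0]. *)
move=> e e0; exists (1 + (4 * e)^-1) => v.
rewrite mulNr opprK.
have vi := sqr_coord_le v i.
have e40 : 0 < (4 * e)^-1 by rewrite invr_gt0 mulr_gt0.
apply: (@le_trans _ _ ((4 * e)^-1 + e * `|v i| ^+ 2)).
  rewrite -subr_ge0 (_ : _ - _ = (1 - 2 * e * `|v i|) ^+ 2 * (4 * e)^-1); last first.
    by field; rewrite gt_eqF.
  by rewrite mulr_ge0 ?sqr_ge0// ltW.
rewrite real_normK ?num_real//.
have ev : e * v i ^+ 2 <= e * sumsq v by rewrite ler_wpM2l// ltW.
have es0 : 0 <= e * sumsq v by rewrite mulr_ge0 ?sumsq_ge0// ltW.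
have E1 := expR_ge1Dx (e * sumsq v).
have : (4 * e)^-1 * 1 <= (4 * e)^-1 * expR (e * sumsq v).
  by apply: ler_wpM2l; [exact: ltW|lra].
by rewrite mulrDl; lra.
Qed.

End Slow.

(** * Normalized Gaussian integration *)

Definition gw n (v : 'I_n -> R) : R := expR (- (sumsq v / 2)).

Definition gexp n (X : ('I_n -> R) -> R) : R :=
  intRn (fun v => X v * gw v) / intRn (@gw n).

Definition gint n (X : ('I_n -> R) -> R) : Prop := good (fun v => X v * gw v).

(** A single term of the exponential series suffices; the two exponentials cover the two signs of
    [x]. *)
Lemma even_power_le_exp (x : R) p : x ^+ p.*2 <= p.*2`!%:R * (expR x + expR (- x)).
Proof.
have F0 : 0 < p.*2`!%:R :> R by rewrite ltr0n fact_gt0.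
have H (y : R) : 0 <= y -> y ^+ p.*2 <= p.*2`!%:R * expR y.
  case: p F0 => [|p] F0 y0; first by rewrite mul1r -[leLHS]expR0 ler_expR.
  rewrite -ler_pdivrMl// mulrC doubleS; have := expR_ge1Dxn p.*2.+1 y0; lra.
have e0 := expR_ge0 x; have e1 := expR_ge0 (- x).
have [x0|x0] := leP 0 x.
  by rewrite (le_trans (H _ x0))// ler_pM2l// lerDl.
rewrite -mul2n exprM -sqrrN -exprM mul2n.
apply: le_trans (H _ _) _; first by rewrite oppr_ge0 ltW.
by rewrite ler_pM2l// lerDr.
Qed.

Section Gint.
Variable n : nat.
Implicit Types X Y : ('I_n -> R) -> R.

Lemma gw_gt0 (v : 'I_n -> R) : 0 < gw v.
Proof. exact: expR_gt0. Qed.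

Lemma borel_gw : borel_fun (@gw n).
Proof.
by apply/borel_expR/borelN/borelM => //; exact: borel_sumsq.
Qed.

Lemma good_slow_gauss X c (a : 'I_n -> R) : 0 < c -> slow X ->
  good (fun v => X v * expR (- (c * sumsq (fun i => v i - a i)))).
Proof.
move=> c0 [mX sX]; split.
  apply: borelM => //; apply/borel_expR/borelN/borelM => //.
  by apply: borel_comp (@borel_sumsq n) _ => j; apply: borelD => //; exact: borel_coord.
have [C XC] := sX (c / 4) (divr_gt0 c0 (ltr0n _ 4)).
(* The translation halves the rate [c], and half of what remains pays for the growth of [X]. *)
exists (C * expR (c * sumsq (fun i => - a i))), (c / 4); split; first by rewrite divr_gt0.
move=> v; rewrite normrM (ger0_norm (expR_ge0 _)).
rewrite (le_trans (ler_wpM2r (expR_ge0 _) (XC v)))// -!mulrA.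
rewrite ler_wpM2l ?(gauss_dom_coeff_ge0 XC)// -!expRD ler_expR.
have := ler_wpM2l (ltW c0) (sumsqD_ge v (fun i => - a i)); lra.
Qed.

Lemma gint_slow X : slow X -> gint X.
Proof.
move=> sX; have := good_slow_gauss (fun _ => 0) (c := 2^-1) _ sX; rewrite invr_gt0 ltr0n.
move=> /(_ isT); congr good; apply/funext => v; rewrite /gw [sumsq v / 2]mulrC.
by rewrite (_ : (fun i => v i - 0) = v)//; apply/funext => i; rewrite subr0.
Qed.

Lemma good_gw : good (@gw n).
Proof. by have := gint_slow (slow_cst n 1); congr good; apply/funext => v; rewrite mul1r. Qed.

End Gint.

Lemma gw_mass_gt0 n : 0 < intRn (@gw n).
Proof.
have gm0 : 0 < gauss_mass 2^-1 :> R by rewrite gauss_mass_gt0.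
elim: n => [|k IH]; first exact: expR_gt0.
suff -> : intRn (@gw k.+1) = gauss_mass 2^-1 * intRn (@gw k) by rewrite mulr_gt0.
rewrite /= -RintegralZr//; last exact: integrable_gaussian.
apply: eq_Rintegral => x _; rewrite -intRnZ; last exact: (@good_gw k).
apply: eq_intRn => v; rewrite /gw -expRD sumsq_vcons; congr expR.
by rewrite mulrDl opprD mulrC.
Qed.

Section Gexp.
Variable n : nat.
Implicit Types X Y : ('I_n -> R) -> R.

Lemma gexpD X Y : gint X -> gint Y -> gexp (fun v => X v + Y v) = gexp X + gexp Y.
Proof.
move=> gX gY; rewrite /gexp -mulrDl -intRnD//; congr (_ / _).
by apply: eq_intRn => v; rewrite mulrDl.
Qed.

Lemma gexpZ a X : gint X -> gexp (fun v => a * X v) = a * gexp X.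
Proof.
move=> gX; rewrite /gexp mulrA -intRnZ//; congr (_ / _).
by apply: eq_intRn => v; rewrite mulrA.
Qed.

Lemma gintD X Y : gint X -> gint Y -> gint (fun v => X v + Y v).
Proof.
by move=> gX gY; have := goodD gX gY; congr good; apply/funext => v; rewrite mulrDl.
Qed.

Lemma gintZ a X : gint X -> gint (fun v => a * X v).
Proof. by move=> gX; have := goodZ a gX; congr good; apply/funext => v; rewrite mulrA. Qed.

Lemma gexp_sum (I : Type) (s : seq I) (h : I -> ('I_n -> R) -> R) :
  (forall i, slow (h i)) -> gexp (fun v => \sum_(i <- s) h i v) = \sum_(i <- s) gexp (h i).
Proof.
move=> sh; elim: s => [|i s IH].
  rewrite big_nil /gexp (eq_intRn (g := fun v => 0 * gw v)).
    by rewrite intRnZ ?mul0r//; exact: good_gw.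
  by move=> v; rewrite big_nil.
rewrite big_cons -IH -gexpD; [|exact: gint_slow|by apply/gint_slow/slow_sum].
by congr gexp; apply/funext => v; rewrite big_cons.
Qed.

Lemma le_gexp X Y : gint X -> gint Y -> (forall v, X v <= Y v) -> gexp X <= gexp Y.
Proof.
move=> gX gY XY; rewrite ler_pM2r ?invr_gt0 ?gw_mass_gt0//.
by apply: le_intRn => // v; rewrite ler_pM2r ?gw_gt0.
Qed.

Lemma gexp_ge0 X : (forall v, 0 <= X v) -> 0 <= gexp X.
Proof.
move=> X0; apply: divr_ge0; last exact: ltW (gw_mass_gt0 n).
by apply: intRn_ge0 => v; rewrite mulr_ge0// ltW// gw_gt0.
Qed.

Lemma gexp_cst a : gexp (fun _ : 'I_n -> R => a) = a.
Proof. by rewrite /gexp intRnZ ?mulfK ?gt_eqF ?gw_mass_gt0//; exact: good_gw. Qed.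

Lemma norm_gexp X : slow X -> `|gexp X| <= gexp (fun v => `|X v|).
Proof.
move=> sX; have sN : slow (fun v => - X v) by exact: slowN.
rewrite ler_norml; apply/andP; split.
  rewrite lerNl -mulN1r -gexpZ; last exact: gint_slow.
  apply: le_gexp; [by apply/gintZ/gint_slow|by apply/gint_slow/slow_norm|].
  by move=> v; rewrite mulN1r -normrN ler_norm.
apply: le_gexp; [exact: gint_slow|by apply/gint_slow/slow_norm|].
by move=> v; exact: ler_norm.
Qed.

(** The Gaussian translated by [c] has density [exp (c . v - |c|^2 / 2)] relative to [gw], and
    translation preserves the mass. *)
Lemma gexp_expR_linear (c : 'I_n -> R) :
  gexp (fun v => expR (\sum_i c i * v i)) = expR (sumsq c / 2).
Proof.
rewrite /gexp (_ : intRn _ = expR (sumsq c / 2) * intRn (@gw n)).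
  by rewrite mulfK// gt_eqF ?gw_mass_gt0.
rewrite -(intRn_translate (fun i => - c i) (good_gw n)) -intRnZ; last exact/good_translate/good_gw.
apply: eq_intRn => v; rewrite /gw -!expRD; congr expR.
rewrite /sumsq !mulr_suml -!sumrN -!big_split/=; apply: eq_bigr => i _; by field.
Qed.

(* Each moment is controlled by the exponential moments at [c] and [-c]. *)
Lemma gexp_linear_moment (c : 'I_n -> R) p : sumsq c <= 1 ->
  gexp (fun v => (\sum_i c i * v i) ^+ p.*2) <= 2 * p.*2`!%:R * expR 1.
Proof.
move=> c1.
have sl (b : 'I_n -> R) : slow (fun v => expR (\sum_i b i * v i)) by exact: slow_expR_linear.
have expR_half : expR (sumsq c / 2) <= expR 1.
  by rewrite ler_expR; lra.
apply: (@le_trans _ _ (gexp (fun v => p.*2`!%:R *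
    (expR (\sum_i c i * v i) + expR (\sum_i (- c i) * v i))))).
  apply: le_gexp.
  - apply/gint_slow/slowX/slow_sum => i; apply: slowM; [exact: slow_cst|exact: slow_coord].
  - by apply/gintZ/gintD; exact/gint_slow.
  move=> v; set x := \sum_i c i * v i.
  have -> : \sum_i - c i * v i = - x by rewrite /x -sumrN; apply: eq_bigr => i _; rewrite mulNr.
  exact: even_power_le_exp.
rewrite gexpZ; last by apply/gintD; exact/gint_slow.
rewrite gexpD; [|exact/gint_slow..].
rewrite !gexp_expR_linear.
have -> : sumsq (fun i => - c i) = sumsq c by apply: eq_bigr => i _; rewrite sqrrN.
rewrite -mulrA mulrCA; apply: ler_wpM2l => //; lra.
Qed.

End Gexp.
End GaussianExpectation.

(** * The two ensembles as Gaussian expectations *)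

Section SphericalMeasures.
Context {R : realType}.
Notation mu := (@lebesgue_measure R).

(** The primitive is [- exp (- t^2 / 2)]. The half-line is encoded by [if] so that the integrand can
    be a slice of a function of [n.+1] variables. *)
Lemma Rintegral_radial_tail (a c : R) : 0 <= a ->
  \int[mu]_t (if a <= t then c * (t * expR (- (t ^+ 2 / 2))) else 0) =
  c * expR (- (a ^+ 2 / 2)).
Proof.
move=> a0.
pose f (t : R) := t * expR (- (t ^+ 2 / 2)).
pose F (t : R) := - expR (- (t ^+ 2 / 2)).
have dF (t : R) : is_derive t 1 F (f t).
  rewrite /F; apply: is_derive_eq; rewrite /f /GRing.scale/=.
  by field.
have cf : continuous f.
  move=> t; apply: cvgM; first exact: cvg_id.
  apply: (continuous_comp (f := fun t : R => - (t ^+ 2 / 2))); last exact: continuous_expR.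
  by apply: cvgN; apply: cvgMl; exact: exprn_continuous.
have f0 t : a <= t -> 0 <= f t by move=> at_; rewrite mulr_ge0 ?expR_ge0// (le_trans a0).
have Fy : F x @[x --> +oo] --> (0 : R).
  rewrite -oppr0; apply: cvgN.
  apply: (cvg_comp (fun x : R => x ^+ 2 / 2) (fun x => expR (- x))); last exact: cvgr_expR.
  by apply: gt0_cvgMly; [rewrite invr_gt0|exact: cvgr_expr2].
have e : mu.-integrable `[a, +oo[ (EFin \o f) /\ \int[mu]_(t in `[a, +oo[) f t = expR (- (a ^+ 2 / 2)).
  have E : (\int[mu]_(x in `[a, +oo[) (f x)%:E = 0%:E - (F a)%:E)%E.
    apply: ge0_continuous_FTC2y => //.
    - exact: continuous_subspaceT.
    - by apply: cvg_at_right_filter; apply: differentiable_continuous; apply/derivable1_diffP; exact: ex_derive.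
    - by move=> x _; rewrite derive1E; exact: derive_val.
  split; last by rewrite /Rintegral E /F /= sub0r opprK.
  apply/integrableP; split.
    by apply/measurable_EFinP; apply: measurable_funTS; exact: continuous_measurable_fun.
  suff -> : (\int[mu]_(x in `[a, +oo[) `|(EFin \o f) x| =
      \int[mu]_(x in `[a, +oo[) (f x)%:E)%E by rewrite E ltry.
  apply: eq_integral => x; rewrite inE/= in_itv/= andbT => ax.
  by rewrite ger0_norm// f0.
rewrite -e.2 -RintegralZl//; last exact: e.1.
rewrite [RHS]Rintegral_mkcond; apply: eq_Rintegral => t _.
rewrite patchE; case: ifPn => at_.
  by rewrite mem_set//= in_itv/= at_.
by rewrite memNset//= in_itv/= andbT; apply/negP.
Qed.

(** * Splitting a vector into its mean and its centered part *)

Definition mean n (G : 'I_n.+1 -> R) : R := sumx G / n.+1%:R.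
Definition centered n (G : 'I_n.+1 -> R) : 'I_n.+1 -> R := fun i => G i - mean G.

Lemma sumx_vsnoc n (v : 'I_n -> R) x : sumx (vsnoc v x) = x + sumx v.
Proof.
rewrite /sumx (bigD1_ord ord_max)//= vsnoc_max.
by under eq_bigr do rewrite vsnoc_lift.
Qed.

Lemma sumsq_vsnoc n (v : 'I_n -> R) x : sumsq (vsnoc v x) = x ^+ 2 + sumsq v.
Proof.
rewrite /sumsq (bigD1_ord ord_max)//= vsnoc_max.
by under eq_bigr do rewrite vsnoc_lift.
Qed.

Lemma sumsq_le_hyp n (y : 'I_n -> R) : sumsq y <= sumsq (hyp y).
Proof. by rewrite [leRHS]sumsq_vsnoc lerDr sqr_ge0. Qed.

Lemma hypZ n l (y : 'I_n -> R) : hyp (fun i => l * y i) = (fun i => l * hyp y i).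
Proof.
apply/funext => i; rewrite /hyp; case: (unlift _ _) => //.
by rewrite mulrN /sumx mulr_sumr.
Qed.

Lemma borel_hyp n i : borel_fun (fun y : 'I_n -> R => hyp y i).
Proof.
case: (unliftP ord_max i) => [j|] ->.
  rewrite (_ : (fun _ => _) = (fun y : 'I_n -> R => y j)); first exact: borel_coord.
  by apply/funext => y; rewrite /hyp liftK.
rewrite (_ : (fun _ => _) = (fun y : 'I_n -> R => - sumx y)); first exact/borelN/borel_sumx.
by apply/funext => y; rewrite /hyp unlift_none.
Qed.

Lemma borel_centered n i : borel_fun (fun G : 'I_n.+1 -> R => centered G i).
Proof.
apply: borelD; first exact: borel_coord.
by apply/borelN/borelM => //; exact: borel_sumx.
Qed.

Lemma sumsq_cst n (a : R) : sumsq (fun _ : 'I_n => a) = n%:R * a ^+ 2.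
Proof. by rewrite /sumsq sumr_const card_ord mulr_natl. Qed.

Lemma sumsq_centered n (G : 'I_n.+1 -> R) :
  sumsq G = sumsq (centered G) + n.+1%:R * mean G ^+ 2.
Proof.
have N0 : n.+1%:R != 0 :> R by rewrite pnatr_eq0.
have -> : sumsq (centered G) = sumsq G - 2 * mean G * sumx G + n.+1%:R * mean G ^+ 2.
  rewrite -sumsq_cst /sumsq /sumx mulr_sumr -sumrB -big_split/=.
  by apply: eq_bigr => i _; rewrite /centered; ring.
rewrite (_ : sumx G = n.+1%:R * mean G); first by ring.
by rewrite /mean; field.
Qed.

Lemma sumsq_centered_le n (G : 'I_n.+1 -> R) : sumsq (centered G) <= sumsq G.
Proof. by rewrite [leRHS]sumsq_centered lerDl mulr_ge0 ?sqr_ge0. Qed.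

(** For fixed [v], the last entry [x] and the mean [a] determine each other by
    [x = n.+1%:R * a - sumx v]; this is the change of variables behind the factor [n.+1%:R]
    below. *)
Lemma centered_vsnoc n (v : 'I_n -> R) x :
  centered (vsnoc v x) = hyp (fun i => v i - mean (vsnoc v x)).
Proof.
apply/funext => i; rewrite /centered; set a := mean _.
case: (unliftP ord_max i) => [j|] ->; first by rewrite vsnoc_lift /hyp liftK.
rewrite vsnoc_max /hyp unlift_none /sumx sumrB sumr_const card_ord -mulr_natl opprB.
have -> : x = n.+1%:R * a - sumx v.
  by rewrite /a /mean sumx_vsnoc mulrC divfK ?pnatr_eq0// addrK.
rewrite /sumx -natr1; ring.
Qed.

(* The hyperplane coordinates and the mean are independent under the Gaussian weight;
   [n.+1%:R * gauss_mass _] is the mass of the mean times the Jacobian. *)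
Lemma intRn_centered n (H : ('I_n.+1 -> R) -> R) :
  good (fun y : 'I_n -> R => H (hyp y) * gw (hyp y)) ->
  intRn (fun G => H (centered G) * gw G) =
  n.+1%:R * gauss_mass (n.+1%:R / 2) * intRn (fun y : 'I_n -> R => H (hyp y) * gw (hyp y)).
Proof.
set L := (fun y : 'I_n -> R => _) => gL.
have N0 : 0 < n.+1%:R :> R by rewrite ltr0n.
(* The integrand in new coordinates: slot [ord0] holds the mean, the others the first [n] entries,
   not yet centered. *)
pose P (w : 'I_n.+1 -> R) :=
  L (fun j => w (lift ord0 j) - w ord0) * expR (- (n.+1%:R / 2 * w ord0 ^+ 2)).
have PE a v : P (vcons a v) = expR (- (n.+1%:R / 2 * a ^+ 2)) * L (fun j => v j - a).
  rewrite /P vcons0 mulrC; congr (_ * L _).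
  by apply/funext => j; rewrite vcons_lift.
have gP : good P.
  have [mL [C [c [c0 LC]]]] := gL; split.
    apply: borelM.
      by apply: (borel_comp mL) => j; apply: borelD; [exact: borel_coord|apply/borelN/borel_coord].
    by apply/borel_expR/borelN/borelM => //; apply/borelX/borel_coord.
  (* With [k <= 1/4], the Gaussian of the mean, of rate [n.+1%:R / 2], absorbs the loss
     [k * n * a ^ 2] caused by shifting [v] by [a]. *)
  pose k := Num.min c 4^-1.
  have k0 : 0 < k by rewrite lt_min c0 invr_gt0 ltr0n.
  have kc : k <= c by rewrite ge_min lexx.
  have k4 : k <= 4^-1 by rewrite ge_min lexx orbT.
  exists C, (k / 2); split; first by rewrite divr_gt0.
  move=> w; rewrite -[in leLHS](vcons_eta w) -[in leRHS](vcons_eta w) PE sumsq_vcons.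
  set a := w ord0; set v := (fun j => w (lift ord0 j)).
  rewrite normrM (ger0_norm (expR_ge0 _)) mulrC.
  rewrite (le_trans (ler_wpM2r (expR_ge0 _) (LC _)))// -!mulrA.
  rewrite ler_wpM2l ?(gauss_dom_coeff_ge0 LC)// -!expRD ler_expR -/v.
  have S0 := sumsq_ge0 (fun j => v j - a).
  have S1 := sumsqD_ge v (fun=> - a); rewrite sumsq_cst sqrrN in S1.
  have a0 := sqr_ge0 a.
  have h1 := ler_wpM2r S0 kc.
  have h2 := ler_wpM2l (ltW k0) S1.
  have na0 : 0 <= n%:R * a ^+ 2 by rewrite mulr_ge0.
  have h3 := ler_wpM2r na0 k4.
  have h4 := ler_wpM2r a0 k4.
  have h5 : n.+1%:R * (2^-1 * a ^+ 2) = n%:R * a ^+ 2 / 2 + a ^+ 2 / 2 by rewrite -natr1; field.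
  rewrite h5; rewrite mulrBr in h2; rewrite -/(sumsq (fun j => v j - a)); lra.
have lineE v : \int[mu]_x (H (centered (vsnoc v x)) * gw (vsnoc v x)) =
    n.+1%:R * \int[mu]_a P (vcons a v).
  have iv0 : 0 < n.+1%:R^-1 :> R by rewrite invr_gt0.
  rewrite [in RHS](Rintegral_affine (sumx v / n.+1%:R) iv0 (good_line v gP)).
  rewrite mulrA mulfV ?gt_eqF// mul1r; apply: eq_Rintegral => x _.
  have -> : n.+1%:R^-1 * x + sumx v / n.+1%:R = mean (vsnoc v x).
    by rewrite /mean sumx_vsnoc mulrDl mulrC.
  rewrite PE centered_vsnoc /L mulrCA; congr (_ * _).
  rewrite /gw sumsq_centered centered_vsnoc -expRD; congr expR; by field.
rewrite intRn_snoc (eq_intRn (g := fun v => n.+1%:R * \int[mu]_a P (vcons a v)))//.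
rewrite intRnZ; last exact: good_Rintegral.
(* The mean becomes the outermost variable; for each of its values the shift by it is undone in the
   others. *)
rewrite -intRn_swap// -mulrA; congr (_ * _) => /=.
rewrite /gauss_mass -RintegralZr//; last first.
  by apply: integrable_gaussian; rewrite divr_gt0.
apply: eq_Rintegral => a _.
rewrite -(intRn_translate (fun=> - a) gL) -intRnZ; last exact: good_translate.
by apply: eq_intRn => v; rewrite PE.
Qed.

(** * Functions of the direction: tilting and layers *)

Definition homogeneous0 n (h : ('I_n -> R) -> R) : Prop :=
  forall l, 0 < l -> forall v, h (fun i => l * v i) = h v.

Lemma good_hyp_gauss n (h : ('I_n.+1 -> R) -> R) B c : 0 < c -> borel_fun h ->
  (forall v, `|h v| <= B) ->
  good (fun y : 'I_n -> R => h (hyp y) * expR (- (c * sumsq (hyp y)))).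
Proof.
move=> c0 mh hB; split.
  apply: borelM; first exact: borel_comp mh (@borel_hyp n).
  apply/borel_expR/borelN/borelM => //.
  exact: borel_comp (@borel_sumsq _ n.+1) (@borel_hyp n).
exists B, c; split => // v; rewrite normrM (ger0_norm (expR_ge0 _)).
by rewrite ler_pM// ler_expR lerN2 ler_pM2l// sumsq_le_hyp.
Qed.

Lemma good_hyp_gw n (h : ('I_n.+1 -> R) -> R) B : borel_fun h ->
  (forall v, `|h v| <= B) -> good (fun y : 'I_n -> R => h (hyp y) * gw (hyp y)).
Proof.
move=> mh hB; have := good_hyp_gauss (c := 2^-1) _ mh hB; rewrite invr_gt0 ltr0n.
by move=> /(_ isT); congr good; apply/funext => y; rewrite /gw [_ / 2]mulrC.
Qed.

(** With [tau ^ 2 = 1 - 2 t] this is the chi-square formula [E exp (t |Y|^2) = (1 - 2 t)^(- n / 2)],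
    valid jointly with any function of the direction; [n] is the dimension of the hyperplane. *)
Lemma gexp_centered_tilt n (h : ('I_n.+1 -> R) -> R) B tau : 0 < tau ->
  borel_fun h -> (forall v, `|h v| <= B) -> homogeneous0 h ->
  gexp (fun G => h (centered G)) =
  tau ^+ n * gexp (fun G => h (centered G) * expR ((1 - tau ^+ 2) / 2 * sumsq (centered G))).
Proof.
move=> t0 mh hB h0; have gL := good_hyp_gw mh hB.
rewrite /gexp mulrA; congr (_ / _); rewrite intRn_centered//.
rewrite (intRn_centered (H := fun w => h w * expR ((1 - tau ^+ 2) / 2 * sumsq w))); last first.
  have := good_hyp_gauss (c := tau ^+ 2 / 2) _ mh hB.
  rewrite divr_gt0 ?exprn_gt0// => /(_ isT); congr good; apply/funext => y.
  by rewrite -[RHS]mulrA /gw -expRD; congr (_ * expR _); field.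
rewrite [RHS]mulrCA; congr (_ * _); rewrite (intRn_scale t0 gL); congr (_ * _).
apply: eq_intRn => y; rewrite hypZ h0// -[RHS]mulrA /gw -expRD sumsqZ; congr (_ * expR _).
by field.
Qed.


Definition ball_integral n (h : ('I_n.+1 -> R) -> R) : R :=
  intRn (fun y : 'I_n -> R => if norm2 (hyp y) <= 1 then h (hyp y) else 0).

Lemma good_layer n (h : ('I_n.+1 -> R) -> R) B : borel_fun h -> (forall v, `|h v| <= B) ->
  good (fun w : 'I_n.+1 -> R => let y := fun j => w (lift ord0 j) in
    if norm2 (hyp y) <= w ord0 then
      h (hyp y) * (w ord0 * expR (- (w ord0 ^+ 2 / 2))) else 0).
Proof.
move=> mh hB; split.
  have mlift j : borel_fun (fun w : 'I_n.+1 -> R => w (lift ord0 j)) by exact: borel_coord.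
  have mhyp i : borel_fun (fun w : 'I_n.+1 -> R => hyp (fun j => w (lift ord0 j)) i).
    exact: borel_comp (@borel_hyp n i) mlift.
  have m0 : borel_fun (fun w : 'I_n.+1 -> R => w ord0) by exact: borel_coord.
  apply: borel_if_le => //; first exact: borel_comp (@borel_norm2 _ _) mhyp.
  apply: borelM; first exact: borel_comp mh mhyp.
  by apply: borelM => //; apply/borel_expR/borelN/borelM => //; exact: borelX.
have B0 : 0 <= B by apply: le_trans (hB (fun=> 0)).
(* [t <= exp (t^2 / 4)] leaves rate [1/4] in [t]; on the support [|y| <= t], so half of it passes to
   [y]. *)
exists B, 8^-1; split; first by rewrite invr_gt0.
move=> w /=; set y := fun j => _; set t := w ord0.
case: ifPn => yt; last by rewrite normr0 mulr_ge0 ?expR_ge0.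
have t0 : 0 <= t by apply: le_trans yt; exact: norm2_ge0.
rewrite normrM ler_pM// normrM (ger0_norm t0) (ger0_norm (expR_ge0 _)).
have tE : t <= expR (t ^+ 2 / 4).
  have := expR_ge1Dx (t ^+ 2 / 4); have := sqr_ge0 (t / 2 - 1); lra.
rewrite (le_trans (ler_wpM2r (expR_ge0 _) tE))// -expRD ler_expR.
have yt2 : sumsq y <= t ^+ 2.
  rewrite (le_trans (sumsq_le_hyp y))// -norm2_sq lerXn2r ?nnegrE//.
  exact: norm2_ge0.
have -> : sumsq w = t ^+ 2 + sumsq y by rewrite -sumsq_vcons vcons_eta.
by lra.
Qed.

(** [t ^+ n] is the Jacobian from the ball of radius [t] to the unit ball. *)
Definition layer_weight n (t : R) : R :=
  if 0 < t then t ^+ n * (t * expR (- (t ^+ 2 / 2))) else 0.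

(* Layer cake: [exp (- |y|^2 / 2)] is the integral over [t >= |y|] of [t exp (- t^2 / 2)]. *)
Lemma intRn_layer n (h : ('I_n.+1 -> R) -> R) B : borel_fun h -> (forall v, `|h v| <= B) ->
  homogeneous0 h ->
  intRn (fun y : 'I_n -> R => h (hyp y) * gw (hyp y)) =
    \int[mu]_t (layer_weight n t * ball_integral h)
  /\ mu.-integrable setT (EFin \o (fun t => layer_weight n t * ball_integral h)).
Proof.
move=> mh hB h0; have gK := good_layer mh hB; set K := (fun w : 'I_n.+1 -> R => _) in gK.
have KE t (y : 'I_n -> R) : K (vcons t y) =
    if norm2 (hyp y) <= t then h (hyp y) * (t * expR (- (t ^+ 2 / 2))) else 0.
  by rewrite /K vcons_tail vcons0.
(* The slice at radius 1 is this function times a positive constant. *)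
have gB : good (fun y : 'I_n -> R => if norm2 (hyp y) <= 1 then h (hyp y) else 0).
  have := goodZ (1 * expR (- (1 ^+ 2 / 2)))^-1 (good_vcons 1 gK); congr good.
  apply/funext => y; rewrite KE; case: ifP => _; last by rewrite mulr0.
  by rewrite mulrCA mulVf ?mulr1// mul1r gt_eqF ?expR_gt0.
have slice t : intRn (fun y => K (vcons t y)) = layer_weight n t * ball_integral h.
  rewrite (eq_intRn (KE t)) /layer_weight; have [t0|t0] := ltP 0 t; last first.
    rewrite mul0r (eq_intRn (g := fun y : 'I_n -> R => 0 * gw y)).
      by rewrite intRnZ ?mul0r//; exact: good_gw.
    move=> y; rewrite mul0r; case: ifPn => // yt.
    have -> : t = 0 by apply/le_anti; rewrite t0 (le_trans (norm2_ge0 _) yt).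
    by rewrite mul0r mulr0.
  have gt := good_vcons t gK.
  rewrite -(eq_intRn (KE t)) (intRn_scale t0 gt) -mulrA; congr (_ * _).
  rewrite -intRnZ//; apply: eq_intRn => y; rewrite KE hypZ (norm2Z _ (ltW t0)) h0//.
  rewrite -[X in _ <= X]mulr1 ler_pM2l//; case: ifP => _; last by rewrite mulr0.
  by rewrite mulrC.
split.
  transitivity (\int[mu]_t intRn (fun y => K (vcons t y))); last first.
    by apply: eq_Rintegral => t _; exact: slice.
  rewrite -[RHS]/(intRn K) intRn_swap//; apply: eq_intRn => y.
  transitivity (\int[mu]_t (if norm2 (hyp y) <= t
      then h (hyp y) * (t * expR (- (t ^+ 2 / 2))) else 0)).
    by rewrite Rintegral_radial_tail ?norm2_ge0// norm2_sq.
  by apply: eq_Rintegral => t _; rewrite KE.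
have := integrable_intRn gK; apply: eq_integrable => // t _ /=.
by rewrite slice.
Qed.


(** The layer formula for [h] and for the constant 1 involves the same radial integral and the same
    mass of the mean; in the quotient only the ratio of ball integrals survives, which is the cone
    measure. *)
Lemma mc_expect_gexp n (m rho : R) (g : ('I_n.+1 -> R) -> R) B :
  borel_fun g -> (forall G, `|g (fun i => m + Num.sqrt ((rho - m ^+ 2) * n.+1%:R) *
    (G i / norm2 G))| <= B) ->
  mc_expect m rho g =
  gexp (fun G => g (fun i => m + Num.sqrt ((rho - m ^+ 2) * n.+1%:R) *
    (centered G i / norm2 (centered G)))).
Proof.
set r := Num.sqrt _ => mg gB.
pose h (w : 'I_n.+1 -> R) := g (fun i => m + r * (w i / norm2 w)).
have mh : borel_fun h.
  apply: (borel_comp mg) => i; apply: borelD => //; apply: borelM => //.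
  apply: borelM; first exact: borel_coord.
  by apply: borelV; [exact: norm2_ge0|exact: borel_norm2].
have h0 : homogeneous0 h.
  move=> l l0 v; rewrite /h; congr g; apply/funext => i.
  by rewrite (norm2Z _ (ltW l0)) -mulf_div divff ?mul1r// gt_eqF.
have b1 : forall v : 'I_n.+1 -> R, `|(fun=> 1 : R) v| <= 1 by move=> v; rewrite normr1.
have [eh ih] := intRn_layer mh gB h0.
have [e1 i1] := @intRn_layer n (fun=> 1) 1 (@borel_cst R _ 1) b1 (fun _ _ _ => erefl).
have N0 : 0 < n.+1%:R :> R by rewrite ltr0n.
pose k : R := n.+1%:R * gauss_mass (n.+1%:R / 2).
have k0 : 0 < k by rewrite mulr_gt0// gauss_mass_gt0// divr_gt0.
have Z1 : intRn (@gw R n.+1) = k * intRn (fun y : 'I_n -> R => 1 * gw (hyp y)).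
  rewrite -(intRn_centered (H := fun=> 1)); last exact: good_hyp_gw b1.
  by apply: eq_intRn => v; rewrite mul1r.
have I0 : 0 < intRn (fun y : 'I_n -> R => 1 * gw (hyp y)).
  by rewrite -(pmulr_rgt0 _ k0) -Z1 gw_mass_gt0.
(* The ball has nonzero volume, for otherwise the layer formula would make the Gaussian mass
   vanish. *)
have B0 : @ball_integral n (fun=> 1) != 0.
  apply/eqP => B0; move: I0; rewrite e1 B0.
  rewrite (_ : Rintegral _ _ _ = 0) ?ltxx//.
  rewrite (_ : (fun _ => _) = (fun=> 0 : R)) ?Rintegral_cst ?mul0r//.
  by apply/funext => t; rewrite mulr0.
(* Dividing by this volume isolates the radial weight. *)
have iw : mu.-integrable setT (EFin \o layer_weight n).
  have := integrableZr measurableT (@ball_integral n (fun=> 1))^-1 i1.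
  by apply: eq_integrable => // t _ /=; rewrite -EFinM mulfK.
rewrite RintegralZr// in eh; rewrite RintegralZr// in e1.
have w0 : \int[mu]_t layer_weight n t != 0.
  by apply/eqP => w0; move: I0; rewrite e1 w0 mul0r ltxx.
rewrite /gexp Z1 (intRn_centered (H := h)); last exact: good_hyp_gw gB.
rewrite eh e1 -/k /mc_expect.
rewrite -[X in X / _ = _]/(ball_integral h) -[X in _ / X = _]/(@ball_integral n (fun=> 1)).
by field; rewrite w0 B0 gt_eqF.
Qed.

(* Completing the square: [exp (- |phi - a|^2 / (2 s))] is the law of [a + sqrt s * G]. *)
Lemma intRn_gauss_affine N (s : R) (a : 'I_N -> R) (g : ('I_N -> R) -> R) : 0 < s ->
  good (fun phi => g phi * expR (- ((2 * s)^-1 * sumsq (fun i => phi i - a i)))) ->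
  intRn (fun phi => g phi * expR (- ((2 * s)^-1 * sumsq (fun i => phi i - a i)))) =
  Num.sqrt s ^+ N * intRn (fun G => g (fun i => a i + Num.sqrt s * G i) * gw G).
Proof.
move=> s0; set k := (fun phi => _) => gk.
have ss0 : 0 < Num.sqrt s by rewrite sqrtr_gt0.
rewrite -(intRn_translate a gk) (intRn_scale ss0); last exact: good_translate.
congr (_ * _); apply: eq_intRn => G; rewrite /k.
rewrite (_ : (fun i => Num.sqrt s * G i + a i - a i) = (fun i => Num.sqrt s * G i)); last first.
  by apply/funext => i; rewrite addrK.
rewrite sumsqZ sqr_sqrtr ?ltW// /gw; congr (g _ * expR (- _)).
  by apply/funext => i; rewrite addrC.
by field; rewrite gt_eqF.
Qed.

(** [cosh] splits into two exponentials, whose squares are completed with the same constant [K]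
    because it depends on [m ^ 2] only; hence the equal weights. *)
Lemma agc_expect_gexp N (s m : R) (g : ('I_N -> R) -> R) : 0 < s -> slow g ->
  agc_expect (m / s) (1 / (2 * s)) g =
  (gexp (fun G => g (fun i => m + Num.sqrt s * G i)) +
   gexp (fun G => g (fun i => - m + Num.sqrt s * G i))) / 2.
Proof.
move=> s0 sg; have s20 : 0 < (2 * s)^-1 by rewrite invr_gt0 mulr_gt0.
pose E (a : R) (phi : 'I_N -> R) := expR (- ((2 * s)^-1 * sumsq (fun i => phi i - a))).
pose K := expR (N%:R * m ^+ 2 * (2 * s)^-1).
have wE phi : agc_weight (m / s) (1 / (2 * s)) phi = K / 2 * (E m phi + E (- m) phi).
  have aux b : (b ^+ 2 = m ^+ 2) -> expR (- (1 / (2 * s) * sumsq phi)) * expR (b / s * sumx phi) = K * E b phi.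
    move=> b2; rewrite /K /E -!expRD; congr expR.
    have -> : sumsq (fun i => phi i - b) = sumsq phi - 2 * b * sumx phi + N%:R * b ^+ 2.
      rewrite -sumsq_cst /sumsq /sumx mulr_sumr -sumrB -big_split/=.
      by apply: eq_bigr => i _; ring.
    by rewrite b2; field; rewrite gt_eqF.
  rewrite /agc_weight /coshR (_ : - (m / s * sumx phi) = - m / s * sumx phi); last by rewrite !mulNr.
  by rewrite mulrA mulrDr aux// aux ?sqrrN//; ring.
have gE (h : ('I_N -> R) -> R) a : slow h -> good (fun phi => h phi * E a phi).
  exact: good_slow_gauss.
have iE (h : ('I_N -> R) -> R) : slow h -> intRn (fun phi => h phi * agc_weight (m / s) (1 / (2 * s)) phi) =
    K / 2 * Num.sqrt s ^+ N * (intRn (fun G => h (fun i => m + Num.sqrt s * G i) * gw G) +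
      intRn (fun G => h (fun i => - m + Num.sqrt s * G i) * gw G)).
  move=> sh; rewrite -[RHS]mulrA mulrDr -!(intRn_gauss_affine (a := fun=> _)); [|by []|exact: gE..|by []|exact: gE].
  rewrite -intRnD; [|exact: gE..]; rewrite -intRnZ; last by apply: goodD; exact: gE.
  by apply: eq_intRn => phi; rewrite wE /E /=; ring.
have Z : intRn (@agc_weight R N (m / s) (1 / (2 * s))) =
    K / 2 * Num.sqrt s ^+ N * (intRn (@gw R N) + intRn (@gw R N)).
  transitivity (intRn (fun phi => (fun=> 1) phi * @agc_weight R N (m / s) (1 / (2 * s)) phi)).
    by apply: eq_intRn => phi /=; rewrite [RHS]mul1r.
  rewrite iE; last exact: slow_cst.
  by congr (_ * (_ + _)); apply: eq_intRn => v /=; rewrite mul1r.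
rewrite /agc_expect iE// Z.
rewrite /gexp.
have Z0 := gw_mass_gt0 (R := R) N.
have K0 : 0 < K by exact: expR_gt0.
have S0 : Num.sqrt s ^+ N != 0 by rewrite gt_eqF ?exprn_gt0 ?sqrtr_gt0.
move: (_ ^+ N) S0 (intRn (@gw R N)) Z0 => q q0 z z0.
have z2 : z + z != 0 by rewrite gt_eqF ?addr_gt0.
by field; rewrite q0 z2 (gt_eqF K0) (gt_eqF z0).
Qed.

End SphericalMeasures.

(** * Concentration of the radius *)

Section Concentration.
Context {R : realType}.

Lemma slow_le n (X W : ('I_n -> R) -> R) : borel_fun X -> slow W ->
  (forall v, `|X v| <= W v) -> slow X.
Proof.
move=> mX [_ sW] XW; split=> // e /sW[C WC]; exists C => v.
exact: le_trans (XW v) (le_trans (ler_norm _) (WC v)).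
Qed.

Lemma slow_centered n (i : 'I_n.+1) : slow (fun G : 'I_n.+1 -> R => centered G i).
Proof.
apply: slowD; first exact: slow_coord.
apply/slowN/slowM; last exact: slow_cst.
by apply: slow_sum => j; exact: slow_coord.
Qed.

Lemma slow_sumsq_centered n : slow (fun G : 'I_n.+1 -> R => sumsq (centered G)).
Proof. by apply: slow_sum => i; apply: slowX; exact: slow_centered. Qed.

Lemma slow_bounded_centered n (h : ('I_n.+1 -> R) -> R) B : borel_fun h ->
  (forall v, `|h v| <= B) -> slow (fun G => h (centered G)).
Proof.
by move=> mh hB; apply: slow_bounded => [|v]; [exact: borel_comp mh (@borel_centered R n)|exact: hB].
Qed.

Lemma gint_centered_tilt n (h : ('I_n.+1 -> R) -> R) B t : borel_fun h -> (forall v, `|h v| <= B) ->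
  t <= 4^-1 -> gint (fun G => h (centered G) * expR (t * sumsq (centered G))).
Proof.
move=> mh hB t4; split.
  apply: borelM; last exact: borel_gw.
  apply: borelM; first exact: borel_comp mh (@borel_centered R n).
  apply/borel_expR/borelM => //.
  exact: borel_comp (@borel_sumsq _ n.+1) (@borel_centered R n).
exists B, 4^-1; split; first by rewrite invr_gt0.
move=> G; rewrite -mulrA normrM ler_pM// ger0_norm; last by rewrite mulr_ge0 ?expR_ge0.
rewrite -expRD ler_expR.
have h1 := ler_wpM2r (sumsq_ge0 (centered G)) t4.
have h2 := sumsq_centered_le G; lra.
Qed.

(** A logarithm-free form of [- ln q <= r]: [1 <= q * (1 + r)] is a polynomial check. *)
Lemma expRN_le (q r : R) : 0 < q -> 1 <= q * (1 + r) -> expR (- r) <= q.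
Proof.
move=> q0 qr; rewrite expRN invf_ple ?posrE ?expR_gt0//.
rewrite -[leLHS]mul1r ler_pdivrMr// mulrC (le_trans qr)// ler_pM2l//.
exact: expR_ge1Dx.
Qed.

(** After squaring: [exp (- 2 t) <= exp 2 * exp (- n r) <= exp 2 * q^n]. *)
Lemma tilt_factor n (t q r : R) : 0 < q -> expR (- r) <= q ->
  n%:R * r - 2 * t <= 2 -> expR (- t) <= expR 1 * Num.sqrt q ^+ n.
Proof.
move=> q0 rq nr; rewrite -ler_sqr ?nnegrE ?mulr_ge0 ?expR_ge0 ?exprn_ge0 ?sqrtr_ge0//.
rewrite exprMn -exprM mulnC exprM sqr_sqrtr ?(ltW q0)// -!expRM_natl.
have : expR (- r) ^+ n <= q ^+ n by apply: lerXn2r => //; rewrite nnegrE ?expR_ge0// ltW.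
rewrite -expRM_natl => /(ler_wpM2l (expR_ge0 (2%:R * 1))) H.
apply: le_trans _ H.
by rewrite -expRD ler_expR; lra.
Qed.

(* Up to a constant, [(|Y|^2 - N)^2] is at most [N (exp (d w / 2) + exp (- d w / 2))] with
   [w = |Y|^2 - N] and [d = 1 / sqrt N]; rescaling the hyperplane absorbs these tilts. *)
Lemma gexp_radial_variance n (h : ('I_n.+1 -> R) -> R) B : (3 <= n)%N ->
  borel_fun h -> (forall v, `|h v| <= B) -> (forall v, 0 <= h v) -> homogeneous0 h ->
  gexp (fun G => h (centered G) * (sumsq (centered G) - n.+1%:R) ^+ 2) <=
  16 * expR 1 * n.+1%:R * gexp (fun G => h (centered G)).
Proof.
move=> n3 mh hB hp h0; set N : R := n.+1%:R.
have N4 : 4 <= N by rewrite /N ler_nat.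
have N0 : 0 < N by lra.
have NE : N = n%:R + 1 by rewrite /N -natr1.
have n0 : 0 <= n%:R :> R by [].
pose d := (Num.sqrt N)^-1.
have d0 : 0 < d by rewrite invr_gt0 sqrtr_gt0.
have d2 : d ^+ 2 = N^-1 by rewrite exprVn sqr_sqrtr// ltW.
have dN : N * d ^+ 2 = 1 by rewrite d2 mulfV ?gt_eqF.
(* This is where [N >= 4] enters: [d <= 1/2] keeps [1 - d] positive and the tilts at most [1/4]. *)
have d12 : d <= 2^-1.
  have : d ^+ 2 <= 4^-1 by rewrite d2 lef_pV2 ?posrE.
  by rewrite !leNgt; apply: contra => ?; nra.
have nd : n%:R * d ^+ 2 <= 1 by have := sqr_ge0 d; rewrite NE in dN; lra.
have Eh0 : 0 <= gexp (fun G => h (centered G)) by exact: gexp_ge0.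
have tilt (t : R) : expR (- (t * N)) <= expR 1 * Num.sqrt (1 - 2 * t) ^+ n -> 0 < 1 - 2 * t ->
    expR (- (t * N)) * gexp (fun G => h (centered G) * expR (t * sumsq (centered G))) <=
    expR 1 * gexp (fun G => h (centered G)).
  move=> tN t2; have s0 : 0 < Num.sqrt (1 - 2 * t) by rewrite sqrtr_gt0.
  rewrite (gexp_centered_tilt s0 mh hB h0) sqr_sqrtr ?(ltW t2)//.
  rewrite (_ : (1 - (1 - 2 * t)) / 2 = t); last by field.
  rewrite (mulrA (expR 1) (_ ^+ n)); apply: ler_wpM2r => //; apply: gexp_ge0 => v; rewrite mulr_ge0 ?expR_ge0//.
have up := tilt (d / 2); have dn := tilt (- (d / 2)).
have {}up : expR (- (d / 2 * N)) * gexp (fun G => h (centered G) * expR (d / 2 * sumsq (centered G))) <=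
    expR 1 * gexp (fun G => h (centered G)).
  apply: up; last by lra.
  rewrite (_ : 2 * (d / 2) = d); last by field.
  (* An upper bound of [- ln (1 - d)] to second order; its linear part cancels [d * N] up to [d],
     and its quadratic part costs at most 2. *)
  apply: (@tilt_factor _ _ _ (d + 2 * d ^+ 2)); first by lra.
    apply: expRN_le; first by lra.
    rewrite (_ : (1 - d) * (1 + (d + 2 * d ^+ 2)) = 1 + d ^+ 2 * (1 - 2 * d)); last by ring.
    by rewrite lerDl mulr_ge0 ?sqr_ge0//; lra.
  rewrite (_ : n%:R * _ - _ = 2 * (n%:R * d ^+ 2) - d); last by rewrite NE; field.
  by lra.
have {}dn : expR (d / 2 * N) * gexp (fun G => h (centered G) * expR (- (d / 2) * sumsq (centered G))) <=
    expR 1 * gexp (fun G => h (centered G)).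
  move: dn; rewrite mulNr opprK; apply; last by lra.
  rewrite (_ : 1 - 2 * - (d / 2) = 1 + d); last by field.
  rewrite -[d / 2 * N]opprK.
  (* The analogous bound of [- ln (1 + d)]. *)
  apply: (@tilt_factor _ _ _ (d ^+ 2 - d)); first by lra.
    apply: expRN_le; first by lra.
    rewrite (_ : (1 + d) * (1 + (d ^+ 2 - d)) = 1 + d ^+ 3); last by ring.
    by rewrite lerDl exprn_ge0// ltW.
  rewrite (_ : n%:R * _ - _ = n%:R * d ^+ 2 + d); last by rewrite NE; field.
  by lra.
have g1 : gint (fun G : 'I_n.+1 -> R => h (centered G) * expR (d / 2 * sumsq (centered G))).
  by apply: gint_centered_tilt mh hB _; clear -d0 d12; lra.
have g2 : gint (fun G : 'I_n.+1 -> R => h (centered G) * expR (- (d / 2) * sumsq (centered G))).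
  by apply: gint_centered_tilt mh hB _; clear -d0 d12; lra.
(* [8 = 4 * 2!]: since [N * d ^ 2 = 1], [(w - N)^2 = 4 N x^2] with [x = d (w - N) / 2], and
   [x^2 <= 2! (exp x + exp (- x))]. *)
apply: (@le_trans _ _ (gexp (fun G => 8 * N *
   (expR (- (d / 2 * N)) * (h (centered G) * expR (d / 2 * sumsq (centered G))) +
    expR (d / 2 * N) * (h (centered G) * expR (- (d / 2) * sumsq (centered G))))))).
  apply: le_gexp.
  - apply/gint_slow/slowM; first exact: slow_bounded_centered hB.
    by apply/slowX/slowD; [exact: slow_sumsq_centered|exact: slow_cst].
  - by apply/gintZ/gintD; exact: gintZ.
  move=> G; set w := sumsq (centered G).
  have := even_power_le_exp (d / 2 * (w - N)) 1; rewrite doubleS/= => e.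
  have -> : 8 * N * (expR (- (d / 2 * N)) * (h (centered G) * expR (d / 2 * w)) +
     expR (d / 2 * N) * (h (centered G) * expR (- (d / 2) * w))) =
    h (centered G) * (4 * N * (2 * (expR (d / 2 * (w - N)) + expR (- (d / 2 * (w - N)))))).
    rewrite (_ : d / 2 * (w - N) = - (d / 2 * N) + d / 2 * w); last by ring.
    rewrite opprD opprK !expRD mulNr; ring.
  have -> : (w - N) ^+ 2 = 4 * N * (d / 2 * (w - N)) ^+ 2.
    transitivity (N * d ^+ 2 * (w - N) ^+ 2); first by rewrite dN mul1r.
    by field.
  by apply: ler_wpM2l => //; rewrite ler_pM2l ?mulr_gt0//.
rewrite gexpZ; last by apply/gintD; exact: gintZ.
rewrite gexpD; [|exact: gintZ..]; rewrite !gexpZ//.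
have -> : 16 * expR 1 * N * gexp (fun G => h (centered G)) =
  8 * N * (expR 1 * gexp (fun G => h (centered G)) + expR 1 * gexp (fun G => h (centered G))) by ring.
by apply: ler_wpM2l; [rewrite mulr_ge0 ?ler0n|exact: lerD].
Qed.

End Concentration.

(** * Coupling of the direction with the Gaussian vector *)

Section Comparison.
Context {R : realType}.

Definition dirn n (G : 'I_n.+1 -> R) (i : 'I_n.+1) : R :=
  centered G i / norm2 (centered G).

Lemma norm_ratio_le1 n (w : 'I_n -> R) i : `|w i / norm2 w| <= 1.
Proof.
rewrite normrM normfV (ger0_norm (norm2_ge0 w)).
have [->|w0] := eqVneq (norm2 w) 0; first by rewrite invr0 mulr0.
by rewrite ler_pdivrMr ?mul1r ?ge_norm2_coord// lt_neqAle eq_sym w0 norm2_ge0.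
Qed.

(** Also true at [Y = 0], where [dirn] is 0 because the inverse of 0 is 0. *)
Lemma centered_dirn n (G : 'I_n.+1 -> R) i : centered G i = dirn G i * norm2 (centered G).
Proof.
rewrite /dirn; have [e|w0] := eqVneq (norm2 (centered G)) 0; last by rewrite divfK.
by rewrite e mulr0; apply/eqP; rewrite -normr_le0 -e ge_norm2_coord.
Qed.

Lemma borel_ratio n (i : 'I_n) : borel_fun (fun w : 'I_n -> R => w i / norm2 w).
Proof.
apply: borelM; first exact: borel_coord.
by apply: borelV; [exact: norm2_ge0|exact: borel_norm2].
Qed.

Lemma slow_dirn n (i : 'I_n.+1) : slow (fun G : 'I_n.+1 -> R => dirn G i).
Proof.
by apply: (slow_bounded_centered (borel_ratio i)) => v; exact: norm_ratio_le1.
Qed.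

Definition moment_bound p : R := 2 * p.*2`!%:R * expR 1.

Definition delta n (i j : 'I_n) : R := (j == i)%:R.

Lemma sum_delta n (i : 'I_n) (v : 'I_n -> R) : \sum_j delta i j * v j = v i.
Proof.
rewrite (bigD1 i)//= /delta eqxx mul1r big1 ?addr0// => j ji.
by rewrite (negbTE ji) mul0r.
Qed.

Lemma sumsq_delta n (i : 'I_n) : sumsq (delta i) = 1.
Proof.
have dii : delta i i = 1 by rewrite /delta eqxx.
rewrite -[RHS]dii -(sum_delta i (delta i)).
by apply: eq_bigr => j _; rewrite expr2.
Qed.

Lemma gexp_coord_moment n (i : 'I_n) p : gexp (fun G : 'I_n -> R => G i ^+ p.*2) <= moment_bound p.
Proof.
have := @gexp_linear_moment R n (delta i) p; rewrite sumsq_delta lexx => /(_ isT).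
by under [X in gexp X]funext do rewrite sum_delta.
Qed.

(** Centering is an orthogonal projection, hence symmetric: [Y_i] is the linear form whose
    coefficients are the projected basis vector, of norm at most 1. *)
Lemma centered_linear n (i : 'I_n.+1) (G : 'I_n.+1 -> R) :
  \sum_j centered (delta i) j * G j = centered G i.
Proof.
have -> : \sum_j centered (delta i) j * G j = \sum_j delta i j * G j - mean (delta i) * sumx G.
  by rewrite /sumx mulr_sumr -sumrB; apply: eq_bigr => j _; rewrite mulrBl.
rewrite sum_delta /centered /mean; congr (_ - _).
have -> : sumx (delta i) = 1.
  by have := sum_delta i (fun=> 1) => <-; apply: eq_bigr => j _; rewrite mulr1.
by rewrite mul1r mulrC.
Qed.

Lemma gexp_centered_moment n (i : 'I_n.+1) p :
  gexp (fun G : 'I_n.+1 -> R => centered G i ^+ p.*2) <= moment_bound p.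
Proof.
have := @gexp_linear_moment R _ (centered (delta i)) p.
rewrite (le_trans (sumsq_centered_le _)) ?sumsq_delta// => /(_ isT).
by under [X in gexp X]funext do rewrite centered_linear.
Qed.

(** [sqrt N * mean] is a linear form with unit coefficient vector. *)
Lemma gexp_mean_sqr n :
  gexp (fun G : 'I_n.+1 -> R => mean G ^+ 2) <= moment_bound 1 / n.+1%:R.
Proof.
have N0 : 0 < n.+1%:R :> R by rewrite ltr0n.
pose d : R := (Num.sqrt n.+1%:R)^-1.
have d2 : d ^+ 2 = n.+1%:R^-1 by rewrite exprVn sqr_sqrtr// ltW.
have c1 : sumsq (fun _ : 'I_n.+1 => d) <= 1 by rewrite sumsq_cst d2 mulfV ?gt_eqF.
have := gexp_linear_moment 1 c1.
rewrite -(ler_pM2r (x := n.+1%:R^-1)) ?invr_gt0// [X in X <= _]mulrC -gexpZ; last first.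
  by apply/gint_slow/slowX/slow_sum => i; apply: slowM; [exact: slow_cst|exact: slow_coord].
congr (gexp _ <= _); apply/funext => G.
by rewrite -mulr_sumr exprMn d2 /mean /sumx; ring.
Qed.

Lemma bernoulli_le (x : R) p : 0 <= x -> 1 + p%:R * (x - 1) <= x ^+ p.
Proof.
move=> x0; elim: p => [|p IH]; first by rewrite mul0r addr0.
rewrite exprS; apply: le_trans (ler_wpM2l x0 IH).
rewrite -subr_ge0 -natr1 (_ : _ - _ = p%:R * (x - 1) ^+ 2); last by ring.
by rewrite mulr_ge0 ?sqr_ge0.
Qed.

(* By Bernoulli and AM-GM, [|Y|^(2p) >= N^p (3/4 - p^2 (|Y|^2 / N - 1)^2)]. *)
Lemma gexp_dirn_moment n (i : 'I_n.+1) p : (3 <= n)%N ->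
  64 * expR 1 * p%:R ^+ 2 <= n.+1%:R :> R ->
  n.+1%:R ^+ p * gexp (fun G : 'I_n.+1 -> R => dirn G i ^+ p.*2) <= 2 * moment_bound p.
Proof.
move=> n3; set N : R := n.+1%:R => Np.
have N0 : 0 < N by rewrite /N ltr0n.
pose h (w : 'I_n.+1 -> R) := (w i / norm2 w) ^+ p.*2.
have hp v : 0 <= h v by rewrite /h -mul2n exprM exprn_ge0// sqr_ge0.
have hB v : `|h v| <= 1 by rewrite normrX exprn_ile1// norm_ratio_le1.
have mh : borel_fun h by apply: borelX; exact: borel_ratio.
have h0 : homogeneous0 h.
  move=> l l0 v; rewrite /h (norm2Z _ (ltW l0)) -mulf_div divff ?mul1r//.
  by rewrite gt_eqF.
have V := gexp_radial_variance n3 mh hB hp h0.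
have Eh0 : 0 <= gexp (fun G => h (centered G)) by exact: gexp_ge0.
have sh : slow (fun G => h (centered G)) by exact: slow_bounded_centered mh hB.
have sw : slow (fun G : 'I_n.+1 -> R => h (centered G) * (sumsq (centered G) - N) ^+ 2).
  apply: slowM => //; apply/slowX/slowD; [exact: slow_sumsq_centered|exact: slow_cst].
have M := gexp_centered_moment i p.
rewrite -/N in V; set Eh := gexp (fun G : 'I_n.+1 -> R => h (centered G)) in V Eh0 *.
have key : N ^+ p * (3 / 4 * Eh + - (p%:R / N) ^+ 2 *
    gexp (fun G => h (centered G) * (sumsq (centered G) - N) ^+ 2)) <= moment_bound p.
  apply: le_trans M; rewrite /Eh -(gexpZ (3 / 4) (gint_slow sh)).
  rewrite -(gexpZ (- (p%:R / N) ^+ 2) (gint_slow sw)) -gexpD; [|exact/gintZ/gint_slow..].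
  rewrite -gexpZ; last by apply/gintD; exact/gintZ/gint_slow.
  apply: le_gexp.
  - by apply/gintZ/gintD; exact/gintZ/gint_slow.
  - by apply/gint_slow/slowX; exact: slow_centered.
  move=> G; set w := sumsq (centered G).
  have w0 : 0 <= w by exact: sumsq_ge0.
  rewrite centered_dirn [leRHS]exprMn -/(h (centered G)).
  have -> : norm2 (centered G) ^+ p.*2 = w ^+ p by rewrite -mul2n exprM norm2_sq.
  rewrite (_ : _ * (_ + _) = h (centered G) * (N ^+ p * (3 / 4 - (p%:R * (w / N - 1)) ^+ 2))); last first.
    by field; rewrite gt_eqF.
  apply: ler_wpM2l => //.
  have wE : w ^+ p = N ^+ p * (w / N) ^+ p by rewrite -exprMn mulrC divfK ?gt_eqF.
  rewrite wE ler_wpM2l ?exprn_ge0 ?(ltW N0)//.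
  have b := bernoulli_le p (divr_ge0 w0 (ltW N0)); apply: le_trans b.
  (* [1 + y >= 3/4 - y^2] is [(y + 1/2)^2 >= 0]. *)
  move: (_ * (_ - 1)) => y; have := sqr_ge0 (y + 2^-1); clear; nra.
(* The threshold [64 e p^2] makes the correction [16 e p^2 / N] at most [1/4], leaving
   [3/4 - 1/4 = 1/2]. *)
have small : (p%:R / N) ^+ 2 * (16 * expR 1 * N * Eh) <= Eh / 4.
  rewrite [leLHS](_ : _ = 64 * expR 1 * p%:R ^+ 2 / N * (Eh / 4)); last by field; rewrite gt_eqF.
  by apply: ler_piMl; [rewrite divr_ge0|rewrite ler_pdivrMr// mul1r].
have V2 := ler_wpM2l (sqr_ge0 (p%:R / N)) V.
have Np0 : 0 <= N ^+ p by rewrite exprn_ge0 ?ltW.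
have : N ^+ p * (Eh / 2) <= moment_bound p.
  apply: le_trans key; apply: ler_wpM2l => //; rewrite mulNr.
  set A := _ * gexp _ in V2 *; set D := _ * _ in small V2; lra.
by rewrite mulrA ler_pdivrMr// [moment_bound p * 2]mulrC.
Qed.

(** [64 e = 2 * 16 e * 2]: the split of the square, the radial variance, the second moment of the
    direction. The other 2 is the share of the mean. *)
Definition coupling_bound : R := (64 * expR 1 + 2) * moment_bound 1.

Lemma gexp_coupling n (i : 'I_n.+1) : (3 <= n)%N -> 64 * expR 1 <= n.+1%:R :> R ->
  gexp (fun G : 'I_n.+1 -> R => (Num.sqrt n.+1%:R * dirn G i - G i) ^+ 2) <=
  coupling_bound / n.+1%:R.
Proof.
move=> n3; set N : R := n.+1%:R => Ne.
have N0 : 0 < N by rewrite /N ltr0n.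
pose h (w : 'I_n.+1 -> R) := (w i / norm2 w) ^+ 2.
have hp v : 0 <= h v by exact: sqr_ge0.
have hB v : `|h v| <= 1 by rewrite normrX exprn_ile1// norm_ratio_le1.
have mh : borel_fun h by apply: borelX; exact: borel_ratio.
have h0 : homogeneous0 h.
  move=> l l0 v; rewrite /h (norm2Z _ (ltW l0)) -mulf_div divff ?mul1r//.
  by rewrite gt_eqF.
have V := gexp_radial_variance n3 mh hB hp h0; rewrite -/N in V.
have U : N * gexp (fun G => h (centered G)) <= 2 * moment_bound 1.
  have := gexp_dirn_moment i (p := 1) n3; rewrite expr1n mulr1 => /(_ Ne).
  by rewrite expr1.
have sw : slow (fun G : 'I_n.+1 -> R => h (centered G) * (sumsq (centered G) - N) ^+ 2).
  apply: slowM; first exact: slow_bounded_centered mh hB.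
  by apply/slowX/slowD; [exact: slow_sumsq_centered|exact: slow_cst].
have sm : slow (fun G : 'I_n.+1 -> R => mean G ^+ 2).
  apply/slowX/slowM; last exact: slow_cst.
  by apply: slow_sum => j; exact: slow_coord.
apply: (@le_trans _ _ (gexp (fun G => 2 / N * (h (centered G) * (sumsq (centered G) - N) ^+ 2) + 2 * mean G ^+ 2))).
  apply: le_gexp.
  - apply/gint_slow/slowX/slowD; last exact/slowN/slow_coord.
    by apply: slowM; [exact: slow_cst|exact: slow_dirn].
  - by apply/gintD; exact/gintZ/gint_slow.
  move=> G; set Y := norm2 (centered G); set u := dirn G i.
  have Y0 : 0 <= Y by exact: norm2_ge0.
  have -> : Num.sqrt N * u - G i = u * (Num.sqrt N - Y) - mean G.
    have := centered_dirn G i; rewrite -/Y -/u /centered => e.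
    by rewrite mulrBr -e; ring.
  rewrite -/(u ^+ 2) -norm2_sq -/Y.
  have sN : Num.sqrt N ^+ 2 = N by rewrite sqr_sqrtr ?ltW.
  have s0 : 0 <= Num.sqrt N by exact: sqrtr_ge0.
  (* Multiplying by the conjugate, so that a small [|Y|] costs nothing. *)
  have q : (Num.sqrt N - Y) ^+ 2 <= (Y ^+ 2 - N) ^+ 2 / N.
    rewrite ler_pdivlMr// -{3}sN.
    rewrite (_ : (Y ^+ 2 - _) ^+ 2 = (Num.sqrt N - Y) ^+ 2 * (Num.sqrt N + Y) ^+ 2); last by ring.
    apply: ler_wpM2l; first exact: sqr_ge0.
    by rewrite -[leLHS]sN lerXn2r ?nnegrE ?addr_ge0 ?lerDl.
  have q2 := ler_wpM2l (sqr_ge0 u) q.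
  have := sqr_ge0 (u * (Num.sqrt N - Y) + mean G).
  rewrite (_ : 2 / N * (h (centered G) * (Y ^+ 2 - N) ^+ 2) = 2 * (u ^+ 2 * ((Y ^+ 2 - N) ^+ 2 / N))); last first.
    by rewrite (_ : h (centered G) = u ^+ 2)//; ring.
  have e1 : (u * (Num.sqrt N - Y) + mean G) ^+ 2 + (u * (Num.sqrt N - Y) - mean G) ^+ 2 =
    2 * (u ^+ 2 * (Num.sqrt N - Y) ^+ 2) + 2 * mean G ^+ 2 by ring.
  move: e1 q2; move: (u ^+ 2 * (_ / N)) => Q.
  move: ((u * (Num.sqrt N - Y) + mean G) ^+ 2) ((u * (Num.sqrt N - Y) - mean G) ^+ 2) => x1 x2.
  by move: (u ^+ 2 * _) (mean G ^+ 2) => x3 x4; clear; lra.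
rewrite gexpD; [|exact/gintZ/gint_slow..]; rewrite !gexpZ; [|exact/gint_slow..].
have m2 := gexp_mean_sqr n; rewrite -/N in m2.
have V2 : 2 / N * gexp (fun G => h (centered G) * (sumsq (centered G) - N) ^+ 2) <=
   64 * expR 1 * (moment_bound 1 / N).
  apply: (@le_trans _ _ (2 / N * (16 * expR 1 * N * gexp (fun G => h (centered G))))).
    by apply: ler_wpM2l => //; rewrite divr_ge0 ?ltW.
  rewrite (_ : 2 / N * _ = 32 * expR 1 / N * (N * gexp (fun G => h (centered G)))); last by ring.
  rewrite (_ : 64 * _ * _ = 32 * expR 1 / N * (2 * moment_bound 1)); last by ring.
  by apply: ler_wpM2l => //; rewrite divr_ge0 ?mulr_ge0 ?expR_ge0 ?ltW.
rewrite (_ : coupling_bound / N = 64 * expR 1 * (moment_bound 1 / N) + 2 * (moment_bound 1 / N)).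
  apply: lerD => //; exact: ler_wpM2l.
by rewrite /coupling_bound; ring.
Qed.

End Comparison.

(** * Test functions and comparison *)

Section TestFunctions.
Context {R : realType}.

Lemma rat_dense_fun k (x : 'I_k -> R) e : 0 < e ->
  exists q : {ffun 'I_k -> rat}, norm2 (fun i => x i - ratr (q i)) < e.
Proof.
move=> e0; pose d := e / k.+1%:R.
have d0 : 0 < d by rewrite divr_gt0.
have /fin_all_exists[q xq] : forall i, exists q : rat, `|x i - ratr q| < d.
  move=> i; have /rat_in_itvoo[q] : x i - d < x i + d by lra.
  by rewrite in_itv/= => /andP[q1 q2]; exists q; rewrite ltr_norml; apply/andP; split; lra.
exists [ffun i => q i]; apply: le_lt_trans (norm2_le_sum _) _.
apply: (@le_lt_trans _ _ (\sum_(i < k) d)).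
  by apply: ler_sum => i _; rewrite ffunE ltW.
rewrite sumr_const card_ord -mulr_natl /d mulrCA gtr_pMr//.
by rewrite ltr_pdivrMr// mul1r ltr_nat.
Qed.

(* [f x] is the supremum of [f q - |x - q|] over rational points [q]. *)
Lemma borel_lipschitz k (f : ('I_k -> R) -> R) :
  (forall x y, `|f x - f y| <= norm2 (fun i => x i - y i)) -> borel_fun f.
Proof.
move=> lf d T c mc mD; apply: (measurability _ (RGenOInfty.measurableE R)) => //.
move=> /= _ [_ [a ->] <-]; rewrite preimage_itvoy.
rewrite [X in measurable X](_ : _ = \bigcup_(q : {ffun 'I_k -> rat})
  ([set: T] `&` [set t | a < f (fun i => ratr (q i)) - norm2 (fun i => c i t - ratr (q i))])).
  apply: countable_bigcupT_measurable => // q; rewrite -preimage_itvoy.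
  have : measurable_fun [set: T] (fun t =>
      f (fun i => ratr (q i)) - norm2 (fun i => c i t - ratr (q i))).
    apply: measurable_funB => //; apply: borel_norm2 => i.
    exact: measurable_funB.
  by apply => //; exact: measurable_itv.
apply/seteqP; split => t /=.
  move=> [_ ft]; have e0 : 0 < (f (c^~ t) - a) / 2 by rewrite divr_gt0// subr_gt0.
  have [q cq] := rat_dense_fun (c^~ t) e0; exists q => //; split=> //.
  have l : f (c^~ t) - f (fun i => ratr (q i)) <= norm2 (fun i => c i t - ratr (q i)).
    exact: le_trans (ler_norm _) (lf _ _).
  have {}cq : norm2 (fun i => c i t - ratr (q i)) < (f (c^~ t) - a) / 2 by exact: cq.
  by move: cq l => /=; move: (norm2 _) (f _) (f _) => *; lra.
move=> [q _ [_ fq]]; split=> //; apply: lt_le_trans fq _.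
by rewrite lerBlDr -lerBlDl (le_trans _ (lf _ _))// distrC ler_norm.
Qed.

Definition growth_weight k (x y : 'I_k -> R) : R := 1 + \sum_i (`|x i| + `|y i|).

(** The polynomial weight makes the class closed under products, so that it holds monomials along
    with Lipschitz functions ([d = 0]). *)
Definition poly_lipschitz k (f : ('I_k -> R) -> R) : Prop :=
  exists L d, 0 <= L /\ forall x y,
    `|f x - f y| <= L * (\sum_i `|x i - y i|) * growth_weight x y ^+ d.

Lemma growth_weight_ge1 k (x y : 'I_k -> R) : 1 <= growth_weight x y.
Proof. by rewrite lerDl sumr_ge0// => i _; exact: addr_ge0. Qed.

(** Comparison with the value at the origin; the extra power of the weight pays for the distance to
    it. *)
Lemma poly_lipschitz_bound k (f : ('I_k -> R) -> R) : poly_lipschitz f ->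
  exists L d, 0 <= L /\ forall x y,
    `|f x| <= L * growth_weight x y ^+ d /\ `|f y| <= L * growth_weight x y ^+ d.
Proof.
move=> [L [d [L0 fL]]]; exists (`|f (fun=> 0)| + L), d.+1; split; first exact: addr_ge0.
suff H x y z : (forall i, `|z i| <= `|x i| + `|y i|) ->
    `|f z| <= (`|f (fun=> 0)| + L) * growth_weight x y ^+ d.+1.
  by move=> x y; split; apply: H => i; rewrite ?lerDl ?lerDr.
move=> zxy; have W1 := growth_weight_ge1 x y; have W0 := le_trans ler01 W1.
have -> : f z = f (fun=> 0) + (f z - f (fun=> 0)) by ring.
apply: le_trans (ler_normD _ _) _; rewrite mulrDl; apply: lerD.
  by rewrite ler_peMr// exprn_ege1.
apply: le_trans (fL _ _) _; rewrite -mulrA exprS; apply: ler_wpM2l => //.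
have S0 : 0 <= \sum_i `|z i - 0| by apply: sumr_ge0.
apply: ler_pM => //; first by rewrite exprn_ge0// (le_trans ler01)// growth_weight_ge1.
  rewrite -[leLHS]add0r; apply: lerD => //; apply: ler_sum => i _.
  by rewrite subr0.
apply: lerXn2r; rewrite ?nnegrE ?(le_trans ler01) ?growth_weight_ge1//.
by rewrite lerD2l; apply: ler_sum => i _; rewrite normr0 addr0.
Qed.

Lemma poly_lipschitzM k (f g : ('I_k -> R) -> R) : poly_lipschitz f -> poly_lipschitz g ->
  poly_lipschitz (fun x => f x * g x).
Proof.
move=> pf pg; have [K1 [e1 [K10 fK]]] := poly_lipschitz_bound pf.
have [K2 [e2 [K20 gK]]] := poly_lipschitz_bound pg.
have [L1 [d1 [L10 fL]]] := pf; have [L2 [d2 [L20 gL]]] := pg.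
exists (L1 * K2 + K1 * L2), (d1 + e2 + (e1 + d2))%N; split.
  by rewrite addr_ge0 ?mulr_ge0.
move=> x y; set S := \sum_i _; set W := growth_weight x y.
have W1 : 1 <= W by exact: growth_weight_ge1.
have S0 : 0 <= S by apply: sumr_ge0.
have WD p q : W ^+ p <= W ^+ (p + q) by rewrite exprD ler_peMr ?exprn_ege1// exprn_ge0 ?(le_trans ler01).
have Wp p : 0 <= W ^+ p by rewrite exprn_ge0// (le_trans ler01).
have -> : f x * g x - f y * g y = (f x - f y) * g x + f y * (g x - g y) by ring.
apply: le_trans (ler_normD _ _) _; rewrite !normrM 2!mulrDl; apply: lerD.
  apply: le_trans (ler_pM (normr_ge0 _) (normr_ge0 _) (fL x y) (gK x y).1) _.
  rewrite -/S -/W (_ : _ * (K2 * _) = L1 * K2 * S * W ^+ (d1 + e2)); last by rewrite exprD; ring.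
  by apply: ler_wpM2l; rewrite ?mulr_ge0.
apply: le_trans (ler_pM (normr_ge0 _) (normr_ge0 _) (fK x y).2 (gL x y)) _.
rewrite -/S -/W (_ : _ * (L2 * _ * _) = K1 * L2 * S * W ^+ (e1 + d2)); last by rewrite exprD; ring.
by rewrite [(d1 + e2 + _)%N]addnC; apply: ler_wpM2l; rewrite ?mulr_ge0.
Qed.

Lemma poly_lipschitz_cst k a : poly_lipschitz (fun _ : 'I_k -> R => a).
Proof. by exists 0, 0%N; split => // x y; rewrite subrr normr0 !mul0r. Qed.

Lemma poly_lipschitz_coord k i : poly_lipschitz (fun x : 'I_k -> R => x i).
Proof.
exists 1, 0%N; split => // x y; rewrite mul1r expr0 mulr1.
by rewrite (bigD1 i)//= lerDl sumr_ge0.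
Qed.

Lemma poly_lipschitz_monomial k (f : ('I_k -> R) -> R) : coord_monomial f -> poly_lipschitz f.
Proof.
move=> [a ->]; elim: (index_enum _) => [|i s IH].
  by under [X in poly_lipschitz X]funext do rewrite big_nil; exact: poly_lipschitz_cst.
under [X in poly_lipschitz X]funext do rewrite big_cons.
apply: poly_lipschitzM IH; elim: (a i) => [|p IH]; first exact: poly_lipschitz_cst.
under [X in poly_lipschitz X]funext do rewrite exprS.
exact: poly_lipschitzM (poly_lipschitz_coord i) IH.
Qed.

Lemma borel_monomial k (f : ('I_k -> R) -> R) : coord_monomial f -> borel_fun f.
Proof.
move=> [a ->] d T c mc; apply: measurable_prod => i _.
exact: measurable_funX.
Qed.

Lemma poly_lipschitz_1lip k (f : ('I_k -> R) -> R) : bounded_1lip f -> poly_lipschitz f.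
Proof.
move=> [_ lf]; exists 1, 0%N; split => // x y; rewrite mul1r mulr1.
exact: le_trans (lf x y) (norm2_le_sum _).
Qed.

Lemma powerD_le (a b : R) p : 0 <= a -> 0 <= b -> (a + b) ^+ p <= 2 ^+ p * (a ^+ p + b ^+ p).
Proof.
move=> a0 b0; have half (x y : R) : 0 <= x -> 0 <= y -> x <= y -> (x + y) ^+ p <= 2 ^+ p * (x ^+ p + y ^+ p).
  move=> x0 y0 xy; apply: (@le_trans _ _ ((2 * y) ^+ p)).
    by apply: lerXn2r; rewrite ?nnegrE ?addr_ge0 ?mulr_ge0//; lra.
  by rewrite exprMn; apply: ler_wpM2l; rewrite ?exprn_ge0// lerDr exprn_ge0.
have [ab|/ltW ab] := leP a b; first exact: half.
by rewrite addrC [_ ^+ p + _]addrC half.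
Qed.

(** [Q] is independent of [c], hence stays fixed when the terms vary with [N]. *)
Lemma power_sum_le (I : Type) (s : seq I) p : exists Q : R, 0 <= Q /\
  forall c : I -> R, (forall i, 0 <= c i) ->
    (1 + \sum_(i <- s) c i) ^+ p <= Q * (1 + \sum_(i <- s) c i ^+ p).
Proof.
elim: s => [|i s [Q [Q0 IH]]].
  by exists 1; split => // c c0; rewrite !big_nil addr0 expr1n mulr1.
exists (2 ^+ p * (Q + 1)); split; first by rewrite mulr_ge0 ?exprn_ge0 ?addr_ge0.
move=> c c0; rewrite !big_cons.
have S0 : 0 <= \sum_(j <- s) c j by apply: sumr_ge0.
have T0 : 0 <= \sum_(j <- s) c j ^+ p by apply: sumr_ge0 => j _; rewrite exprn_ge0.
rewrite (addrCA 1) [c i + (1 + _)]addrC.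
apply: le_trans (powerD_le _ (addr_ge0 ler01 S0) (c0 i)) _.
rewrite -mulrA; apply: ler_wpM2l; first by rewrite exprn_ge0.
have := IH c c0; have ci : 0 <= c i ^+ p by rewrite exprn_ge0.
have := mulr_ge0 Q0 ci.
move: (\sum_(j <- s) c j ^+ p) T0 (_ ^+ p) (c i ^+ p) ci => T T0 z w w0; lra.
Qed.

Lemma gexpB n (X Y : ('I_n -> R) -> R) : slow X -> slow Y ->
  gexp (fun v => X v - Y v) = gexp X - gexp Y.
Proof.
move=> sX sY; rewrite (gexpD (gint_slow sX) (gint_slow (slowN sY))); congr (_ + _).
rewrite -mulN1r -gexpZ; last exact: gint_slow.
by congr gexp; apply/funext => v; rewrite mulN1r.
Qed.

(** [C] and [N0] precede [n] and [iota]: the moment bounds involve neither the dimension nor the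
    choice of sites. *)
Lemma gexp_compare k (f : ('I_k -> R) -> R) (m s : R) : 0 < s -> borel_fun f ->
  poly_lipschitz f -> exists (C : R) (N0 : nat), forall n (iota : 'I_k -> 'I_n.+1),
  (N0 <= n.+1)%N ->
  `|gexp (fun G : 'I_n.+1 -> R => f (fun j => m + Num.sqrt (s * n.+1%:R) * dirn G (iota j))) -
    gexp (fun G : 'I_n.+1 -> R => f (fun j => m + Num.sqrt s * G (iota j)))| <=
  C / Num.sqrt n.+1%:R.
Proof.
move=> s0 mf pf; have [L [d [L0 fL]]] := pf; have [Lb [e [Lb0 fb]]] := poly_lipschitz_bound pf.
have [Q [Q0 HQ]] := power_sum_le (index_enum 'I_k) d.*2.
set r := Num.sqrt s; have r0 : 0 <= r by exact: sqrtr_ge0.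
(* The map [x |-> m + r * x] enlarges the growth weight by at most this factor. *)
pose K := 1 + (k%:R * (2 * `|m|) + r).
have K1 : 1 <= K by rewrite lerDl addr_ge0// mulr_ge0// mulr_ge0.
have K0 : 0 <= K by exact: le_trans K1.
pose c2 := 2 ^+ d.*2 * (2 * moment_bound d + moment_bound d) : R.
pose C := L * r * K ^+ d * (k%:R * ((coupling_bound + Q * (1 + k%:R * c2)) / 2)).
(* The 4 ensures [3 <= n]; the factor [1 + d^2] serves the thresholds of both the coupling and the
   moment of order [2 d]. *)
exists C, (4 + Num.bound (64 * expR 1 * (1 + d%:R ^+ 2) : R))%N => n iota hN.
set N : R := n.+1%:R.
have N0 : 0 < N by rewrite /N ltr0n.
have n3 : (3 <= n)%N by rewrite -ltnS (leq_trans _ hN)// -[X in (X <= _)%N]addn0 leq_add.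
have NB : 64 * expR 1 * (1 + d%:R ^+ 2) <= N.
  apply: (@le_trans _ _ (Num.bound (64 * expR 1 * (1 + d%:R ^+ 2) : R))%:R).
    by apply/ltW/archi_boundP; rewrite !mulr_ge0 ?expR_ge0 ?addr_ge0 ?exprn_ge0.
  by rewrite ler_nat (leq_trans _ hN)// leq_addl.
have e64 : 0 <= 64 * expR 1 :> R by rewrite mulr_ge0 ?expR_ge0.
have N1 : 64 * expR 1 <= N.
  by apply: le_trans NB; rewrite ler_peMr// lerDl exprn_ge0.
have N2 : 64 * expR 1 * d%:R ^+ 2 <= N.
  by apply: le_trans NB; apply: ler_wpM2l => //; rewrite lerDr.
pose q := Num.sqrt N; have q0 : 0 < q by rewrite sqrtr_gt0.
have qN : q * q = N by rewrite -expr2 sqr_sqrtr ?ltW.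
pose A (G : 'I_n.+1 -> R) j := q * dirn G (iota j).
pose B (G : 'I_n.+1 -> R) j := G (iota j).
have sA j : slow (fun G => A G j) by apply: slowM; [exact: slow_cst|exact: slow_dirn].
have sB j : slow (fun G => B G j) by exact: slow_coord.
pose W (G : 'I_n.+1 -> R) := 1 + \sum_j (`|A G j| + `|B G j|).
have sW : slow W.
  by apply: slowD; [exact: slow_cst|apply: slow_sum => j; apply: slowD; exact: slow_norm].
pose X (G : 'I_n.+1 -> R) j := m + r * A G j.
pose Y (G : 'I_n.+1 -> R) j := m + r * B G j.
have weight G : growth_weight (X G) (Y G) <= K * W G.
  apply: (@le_trans _ _ (1 + \sum_j (2 * `|m| + r * (`|A G j| + `|B G j|)))).
    rewrite lerD2l; apply: ler_sum => j _.
    apply: le_trans (lerD (ler_normD _ _) (ler_normD _ _)) _.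
    by rewrite !normrM (ger0_norm r0); lra.
  rewrite big_split/= sumr_const card_ord -[X in _ + (X + _)]mulr_natl.
  rewrite -[X in _ + (_ + X)]mulr_sumr /W /K.
  have S0 : 0 <= \sum_j (`|A G j| + `|B G j|) by apply: sumr_ge0 => j _; exact: addr_ge0.
  have h1 : 0 <= k%:R * (2 * `|m|) by rewrite mulr_ge0// mulr_ge0.
  move: S0 h1 (mulr_ge0 h1 S0); move: (\sum_j (`|A G j| + _)) (k%:R * _) => S z S0 z0 zS.
  by clear -r0 zS S0 z0; lra.
have sfb (Z : ('I_n.+1 -> R) -> 'I_k -> R) : (forall j, slow (fun G => Z G j)) ->
    (forall G, `|f (Z G)| <= Lb * growth_weight (X G) (Y G) ^+ e) -> slow (fun G => f (Z G)).
  move=> sZ ZL; apply: (@slow_le _ _ _ (fun G => Lb * (K * W G) ^+ e)).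
  - by apply: (borel_comp mf) => j; exact: (sZ j).1.
  - by apply: slowM; [exact: slow_cst|apply/slowX/slowM => //; exact: slow_cst].
  move=> G; apply: le_trans (ZL G) _; apply: ler_wpM2l => //.
  have W1 := growth_weight_ge1 (X G) (Y G).
  by apply: lerXn2r; rewrite ?nnegrE ?(le_trans ler01 W1) ?(le_trans (le_trans ler01 W1) (weight G)).
have saff (Z : ('I_n.+1 -> R) -> 'I_k -> R) : (forall j, slow (fun G => Z G j)) ->
    forall j, slow (fun G => m + r * Z G j).
  by move=> sZ j; apply: slowD; [exact: slow_cst|apply: slowM => //; exact: slow_cst].
have sX : slow (fun G => f (X G)).
  by apply: sfb => [|G]; [exact: saff|exact: (fb _ _).1].
have sY : slow (fun G => f (Y G)).
  by apply: sfb => [|G]; [exact: saff|exact: (fb _ _).2].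
have sD : slow (fun G => f (X G) - f (Y G)) by apply: slowD => //; exact: slowN.
have -> : gexp (fun G : 'I_n.+1 -> R => f (fun j => m + Num.sqrt (s * N) * dirn G (iota j))) =
    gexp (fun G => f (X G)).
  congr gexp; apply/funext => G; congr f; apply/funext => j.
  by rewrite /X /A sqrtrM ?ltW// mulrA.
rewrite -[X in _ - X]/(gexp (fun G => f (Y G))) -gexpB//.
apply: le_trans (norm_gexp sD) _.
(* Even powers dispose of the absolute values, leaving moments bounded uniformly in [N]. *)
pose V (G : 'I_n.+1 -> R) := 1 + \sum_j (2 ^+ d.*2 * (A G j ^+ d.*2 + B G j ^+ d.*2)).
have sV : slow V.
  apply: slowD; first exact: slow_cst.
  by apply: slow_sum => j; apply: slowM; [exact: slow_cst|apply: slowD; exact: slowX].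
have WV G : W G ^+ d.*2 <= Q * V G.
  apply: le_trans (HQ _ _) _; first by move=> j; exact: addr_ge0.
  apply: ler_wpM2l => //; rewrite lerD2l; apply: ler_sum => j _.
  apply: le_trans (powerD_le _ _ _) _ => //.
  by rewrite -!normrX !ger0_norm// -mul2n exprM exprn_ge0 ?sqr_ge0.
(* AM-GM weighted by [q = sqrt N]: the squared distance has mean of order [1 / N] and [V] of order
   1, so both terms are of order [1 / q]. *)
pose P j (G : 'I_n.+1 -> R) := q / 2 * (A G j - B G j) ^+ 2 + Q / (2 * q) * V G.
have sAB j : slow (fun G => (A G j - B G j) ^+ 2) by apply/slowX/slowD => //; exact: slowN.
have sP j : slow (P j) by apply: slowD; apply: slowM => //; exact: slow_cst.
have pointwise G : `|f (X G) - f (Y G)| <= L * r * K ^+ d * \sum_j P j G.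
  apply: le_trans (fL _ _) _.
  have -> : \sum_i `|X G i - Y G i| = r * \sum_i `|A G i - B G i|.
    rewrite mulr_sumr; apply: eq_bigr => j _.
    by rewrite /X /Y -(ger0_norm r0) -normrM (ger0_norm r0); congr `|_|; ring.
  have S0 : 0 <= \sum_i `|A G i - B G i| by apply: sumr_ge0.
  have W1 := growth_weight_ge1 (X G) (Y G).
  have : growth_weight (X G) (Y G) ^+ d <= (K * W G) ^+ d.
    by apply: lerXn2r; rewrite ?nnegrE ?(le_trans ler01 W1) ?(le_trans (le_trans ler01 W1) (weight G)).
  move=> /(ler_wpM2l (mulr_ge0 L0 (mulr_ge0 r0 S0))) /le_trans; apply.
  rewrite exprMn [leLHS](_ : _ = L * r * K ^+ d * ((\sum_i `|A G i - B G i|) * W G ^+ d)); last by ring.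
  apply: ler_wpM2l; first by rewrite !mulr_ge0 ?exprn_ge0.
  rewrite mulr_suml; apply: ler_sum => j _.
  apply: (@le_trans _ _ (q / 2 * `|A G j - B G j| ^+ 2 + (2 * q)^-1 * W G ^+ d.*2)).
    rewrite -muln2 exprM -subr_ge0.
    rewrite (_ : _ - _ = (q * `|A G j - B G j| - W G ^+ d) ^+ 2 / (2 * q)).
      by rewrite divr_ge0 ?sqr_ge0// mulr_ge0// ltW.
    by field; rewrite gt_eqF.
  rewrite real_normK ?num_real// /P; apply: lerD => //.
  rewrite (_ : Q / (2 * q) * V G = (2 * q)^-1 * (Q * V G)); last by ring.
  by apply: ler_wpM2l => //; rewrite invr_ge0 mulr_ge0 ?ltW.
have sAd j : slow (fun G => A G j ^+ d.*2) by exact: slowX.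
have sBd j : slow (fun G => B G j ^+ d.*2) by exact: slowX.
have EV : gexp V <= 1 + k%:R * c2.
  have sT j : slow (fun G => 2 ^+ d.*2 * (A G j ^+ d.*2 + B G j ^+ d.*2)).
    by apply: slowM; [exact: slow_cst|exact: slowD].
  rewrite /V (gexpD (gint_slow (slow_cst _ 1)) (gint_slow (slow_sum _ sT))) gexp_cst lerD2l.
  rewrite gexp_sum//; apply: (@le_trans _ _ (\sum_(j < k) c2)); last first.
    by rewrite sumr_const card_ord mulr_natl.
  apply: ler_sum => j _; rewrite (gexpZ _ (gint_slow (slowD (sAd j) (sBd j)))).
  apply: ler_wpM2l; first by rewrite exprn_ge0.
  rewrite (gexpD (gint_slow (sAd j)) (gint_slow (sBd j))); apply: lerD.
    apply: le_trans (gexp_dirn_moment (iota j) n3 N2); rewrite -gexpZ; last first.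
      exact/gint_slow/slowX/slow_dirn.
    rewrite le_eqVlt; apply/orP; left; apply/eqP; congr gexp; apply/funext => G.
    by rewrite /A exprMn -[X in q ^+ X]mul2n exprM expr2 qN.
  exact: gexp_coord_moment.
have EP j : gexp (P j) <= (coupling_bound + Q * (1 + k%:R * c2)) / 2 / q.
  rewrite /P gexpD ?(gexpZ _ (gint_slow (sAB j))) ?(gexpZ _ (gint_slow sV)); [|exact/gintZ/gint_slow..].
  have -> : (coupling_bound + Q * (1 + k%:R * c2)) / 2 / q =
      q / 2 * (coupling_bound / N) + Q / (2 * q) * (1 + k%:R * c2).
    by rewrite -qN; field; rewrite gt_eqF.
  apply: lerD; apply: ler_wpM2l => //; first by rewrite divr_ge0 ?ltW.
    exact: gexp_coupling.
  by rewrite divr_ge0 // mulr_ge0 // ltW.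
apply: (@le_trans _ _ (gexp (fun G => L * r * K ^+ d * \sum_j P j G))).
  by apply: le_gexp => //; [exact/gint_slow/slow_norm|exact/gintZ/gint_slow/slow_sum].
rewrite gexpZ ?gexp_sum//; last exact/gint_slow/slow_sum.
rewrite /C -!mulrA; do 3 (apply: ler_wpM2l; first by rewrite ?exprn_ge0).
apply: (@le_trans _ _ (\sum_(j < k) (coupling_bound + Q * (1 + k%:R * c2)) / 2 / q)).
  by apply: ler_sum => j _.
by rewrite sumr_const card_ord -mulr_natl le_eqVlt; apply/orP; left; apply/eqP; ring.
Qed.

End TestFunctions.

Theorem theorem4p30 (R : realType) (J rho eps : R) (k : nat)
    (f : ('I_k -> R) -> R) :
  0 < J -> 0 < rho -> - (J * rho / 2) < eps -> eps <= 0 ->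
  bounded_1lip f \/ coord_monomial f ->
  exists (C : R) (N0 : nat), forall (N : nat) (iota : 'I_k -> 'I_N),
    (N0 <= N)%N -> injective iota ->
    `| mc_eps_expect J eps rho (fun phi => f (projI iota phi))
       - agc_expect (mubar J eps rho) (eta_of J eps rho)
           (fun phi => f (projI iota phi)) |
    <= C / Num.sqrt (N%:R).
Proof.
move=> J0 rho0 eps_gt eps0 hf.
have mf : borel_fun f by case: hf => [[_ /borel_lipschitz]|/borel_monomial].
have pf : poly_lipschitz f by case: hf => [/poly_lipschitz_1lip|/poly_lipschitz_monomial].
set m := Num.sqrt (- (2 * eps) / J); set s := rho - - (2 * eps) / J.
have m2 : m ^+ 2 = - (2 * eps) / J.
  by rewrite sqr_sqrtr // divr_ge0 //; [lra|exact: ltW].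
have s0 : 0 < s.
  have : - (2 * eps) / J < rho by rewrite ltr_pdivrMr//; lra.
  by rewrite /s subr_gt0.
have [C1 [N1 H1]] := gexp_compare m s0 mf pf.
have [C2 [N2 H2]] := gexp_compare (- m) s0 mf pf.
(* The successor excludes [N = 0]. *)
exists ((C1 + C2) / 2), (N1 + N2).+1 => -[//|n] iota hN _.
set g := (fun phi => f (projI iota phi)).
have mg : borel_fun g by apply: (borel_comp mf) => j; exact: borel_coord.
have [Lb [e [Lb0 fb]]] := poly_lipschitz_bound pf.
have sg : slow g.
  apply: (@slow_le _ _ _ (fun phi => Lb * (1 + \sum_j (`|phi (iota j)| + `|phi (iota j)|)) ^+ e)) => //.
    apply: slowM; first exact: slow_cst.
    apply/slowX/slowD; first exact: slow_cst.
    by apply: slow_sum => j; apply: slowD; apply/slow_norm/slow_coord.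
  by move=> phi; exact: (fb (projI iota phi) (projI iota phi)).1.
have mcE a : a ^+ 2 = m ^+ 2 -> mc_expect a rho g =
    gexp (fun G : 'I_n.+1 -> R => f (fun j => a + Num.sqrt (s * n.+1%:R) * dirn G (iota j))).
  move=> am; have rE : rho - a ^+ 2 = s by rewrite am m2.
  (* Coordinates on the sphere are at most [|a| + r] in absolute value, so even a monomial is
     bounded there. *)
  pose b : 'I_k -> R := fun=> `|a| + Num.sqrt (s * n.+1%:R).
  rewrite (@mc_expect_gexp _ _ _ _ _ (Lb * growth_weight b b ^+ e)) ?rE//.
  move=> G; apply: le_trans (fb _ (fun=> 0)).1 _; apply: ler_wpM2l => //.
  apply: lerXn2r; rewrite ?nnegrE ?(le_trans ler01 (growth_weight_ge1 _ _))//.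
  rewrite lerD2l; apply: ler_sum => j _; rewrite normr0 addr0 /projI.
  have b0 : 0 <= b j by rewrite addr_ge0 ?sqrtr_ge0.
  rewrite (ger0_norm b0) (le_trans (ler_normD _ _))// (@le_trans _ _ (b j)) ?lerDl//.
  rewrite lerD2l normrM (ger0_norm (sqrtr_ge0 _)) ler_piMr ?sqrtr_ge0//.
  exact: norm_ratio_le1.
(* At [eps = 0] both magnetizations are 0, and the average reduces to the single ensemble. *)
have -> : mc_eps_expect J eps rho g = (mc_expect m rho g + mc_expect (- m) rho g) / 2.
  rewrite /mc_eps_expect; case: eqP => // e0.
  have -> : m = 0 by rewrite /m e0 mulr0 oppr0 mul0r sqrtr0.
  by rewrite oppr0; field.
rewrite (agc_expect_gexp m s0 sg) !mcE ?sqrrN//.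
have h1 := H1 n iota (leq_trans (leq_trans (leq_addr N2 N1) (leqnSn _)) hN).
have h2 := H2 n iota (leq_trans (leq_trans (leq_addl N1 N2) (leqnSn _)) hN).
rewrite -mulrBl normrM (ger0_norm (x := 2^-1)) ?invr_ge0// mulrAC ler_pM2r ?invr_gt0//.
rewrite [leRHS]mulrDl; apply: le_trans _ (lerD h1 h2); apply: le_trans _ (ler_normD _ _).
rewrite le_eqVlt; apply/orP; left; apply/eqP; congr `|_|; rewrite /g /projI; ring.
Qed.
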